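(* Let $\&$ be a continuous t-norm and let $M>0$. Then $(\mathbb{E}^1_{[-M,M]},P)$ is a $[0,1]$-enriched domain if and only if $\&$ satisfies the (S) condition.
   Context: T-norms: a t-norm is a commutative, associative binary operation $\&$ on $[0,1]$, monotone in each variable, with $x\,\&\,1=x$. Its residual implication is $x\to y=\sup\{t\in[0,1]\mid x\,\&\,t\le y\}$. A continuous t-norm satisfies the (S) condition if it satisfies one (equivalently, by a known result, all) of: (i) for each non-idempotent $p\in[0,1]$, with $p^-$ the greatest idempotent in $[0,p]$ and $p^+$ the least idempotent in $[p,1]$, the restriction of $\&$ to $[p^-,p^+]$ is isomorphic to the product t-norm on $[0,1]$ whenever $p^->0$; (ii) $\to:[0,1]^2\to[0,1]$ is continuous at every point off the diagonal $\{(x,x)\}$; (iii) for each $p\in(0,1]$, the function $p\to-$ is continuous on $[0,p)$. Fuzzy numbers: $\mathbb{E}^1$ is the set of functions $u:\mathbb{R}\to[0,1]$ such that (1) $u(x_0)=1$ for some $x_0$; (2) $u(\lambda x+(1-\lambda)y)\ge\min\{u(x),u(y)\}$ for all $x,y\in\mathbb{R},\lambda\in[0,1]$; (3) $u$ is upper-semicontinuous; (4) $[u]_0=\overline{\{x: u(x)>0\}}$ is compact. Put $[u]_\alpha=\{x: u(x)\ge\alpha\}$ for $\alpha\in(0,1]$ and write $[u]_\alpha=[u_\alpha^-,u_\alpha^+]$. The left and right parts of $u$ are $u^\ell,u^r:\mathbb{R}\to[0,1]$: $u^\ell(x)=0$ for $x<u_0^-$, $u^\ell(x)=u(x)$ for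 $x\in[u_0^-,u_1^-]$, $u^\ell(x)=1$ for $x>u_1^-$; $u^r(x)=1$ for $x<u_1^-$, $u^r(x)=u(x)$ for $x\in[u_1^-,u_0^+]$, $u^r(x)=0$ for $x>u_0^+$. Define $P(u,v)=\inf_{x\in\mathbb{R}}\big((v^\ell(x)\to u^\ell(x))\wedge(u^r(x)\to v^r(x))\big)$. For $M>0$, $\mathbb{E}^1_{[-M,M]}$ is the set of $u\in\mathbb{E}^1$ with support $[u]_0\subseteq[-M,M]$. Enriched categories: a $[0,1]$-enriched category is a set $X$ with a map $X(-,-):X\times X\to[0,1]$ such that $X(x,x)=1$ and $X(y,z)\,\&\,X(x,y)\le X(x,z)$. Here $X=\mathbb{E}^1_{[-M,M]}$ and $X(u,v)=P(u,v)$. A functor $f:X\to Y$ is a map with $X(x,y)\le Y(f(x),f(y))$; a functor $f:X\to Y$ is left adjoint to a functor $g:Y\to X$ if $Y(f(x),y)=X(x,g(y))$ for all $x,y$. A weight is a map $\phi:X\to[0,1]$ with $X(y,x)\le\phi(x)\to\phi(y)$; a colimit of $\phi$ is an element $\operatorname{colim}\phi$ with $X(\operatorname{colim}\phi,x)=\inf_{y\in X}(\phi(y)\to X(y,x))$ for all $x$. A net $\{x_i\}_{i\in D}$ is forward Cauchy if $\sup_{i\in D}\inf_{k\ge j\ge i}X(x_j,x_k)=1$. A forward Cauchy ideal is a weight of the form $\sup_{i\in D}\inf_{j\ge i}X(-,x_j)$ for some forward Cauchy net; the set of these is $\mathcal{I}X$, a $[0,1]$-enriched category with $\mathcal{I}X(\phi_1,\phi_2)=\inf_{x\in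 X}(\phi_1(x)\to\phi_2(x))$. $X$ is Yoneda complete if every forward Cauchy ideal has a colimit; $X$ is continuous if $\operatorname{colim}:\mathcal{I}X\to X$ has a left adjoint; a $[0,1]$-enriched domain is a Yoneda complete and continuous $[0,1]$-enriched category. *)

(* Defs.v *)
From mathcomp Require Import all_boot all_order all_algebra.
From mathcomp Require Import all_classical all_reals all_analysis.
Set Implicit Arguments.
Unset Strict Implicit.
Unset Printing Implicit Defensive.
Import Order.TTheory GRing.Theory Num.Theory.
Import numFieldNormedType.Exports.
Local Open Scope classical_set_scope.
Local Open Scope ring_scope.

(* Elements of [0,1] are represented by elements of [R], so a t-norm, a weight
   or a hom-map is a function with values in [R] that is required to stay in
   [I01]; nothing is assumed about a t-norm outside of the unit square. *)
Definition I01 {R : realType} : set R := [set` `[0%R, 1%R]].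

Definition square01 {R : realType} : set (R * R) := I01 `*` I01.

(* The infimum in the complete lattice [0,1]: the infimum of the empty set is 1
   there, while [inf set0 = 0] in [R]. The same care is not needed for suprema,
   since [sup set0 = 0]. *)
Definition inf01 {R : realType} (A : set R) : R := inf (1 |` A).

Section Tnorms.
Variables (R : realType) (T : R -> R -> R).

Definition tnorm : Prop :=
  [/\ forall x y, I01 x -> I01 y -> I01 (T x y),
      forall x y, I01 x -> I01 y -> T x y = T y x,
      forall x y z, I01 x -> I01 y -> I01 z -> T x (T y z) = T (T x y) z,
      forall x x' y y', I01 x -> I01 x' -> I01 y -> I01 y' ->
        x <= x' -> y <= y' -> T x y <= T x' y'
    & forall x, I01 x -> T x 1 = x].

Definition continuous_tnorm : Prop :=
  tnorm /\ {within square01, continuous (fun q : R * R => T q.1 q.2)}.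

Definition residuum (x y : R) : R := sup [set t | I01 t /\ T x t <= y].

Definition idempotent_elt (p : R) : Prop := I01 p /\ T p p = p.

Definition greatest_idempotent_below (p a : R) : Prop :=
  [/\ idempotent_elt a, a <= p
    & forall e, idempotent_elt e -> e <= p -> e <= a].

Definition least_idempotent_above (p b : R) : Prop :=
  [/\ idempotent_elt b, p <= b
    & forall e, idempotent_elt e -> p <= e -> b <= e].

Definition isomorphic_to_product (a b : R) : Prop :=
  exists phi : R -> R,
    [/\ set_bij [set` `[a, b]] I01 phi,
        {in `[a, b] &, {mono phi : x y / x <= y}}
      & {in `[a, b] &, forall x y, phi (T x y) = phi x * phi y}].

Definition S_product : Prop :=
  forall p a b, I01 p -> ~ idempotent_elt p ->
    greatest_idempotent_below p a -> least_idempotent_above p b ->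
    0 < a -> isomorphic_to_product a b.

Definition S_off_diagonal : Prop :=
  forall x y, I01 x -> I01 y -> x <> y ->
    (fun q : R * R => residuum q.1 q.2) @ within square01 (nbhs (x, y))
      --> residuum x y.

Definition S_sections : Prop :=
  forall p : R, 0 < p <= 1 -> {within [set` `[0, p[], continuous (residuum p)}.

(* The three conditions are equivalent for a continuous t-norm. *)
Definition S_condition : Prop := [\/ S_product, S_off_diagonal | S_sections].

End Tnorms.

Section Enriched.
Variables (R : realType) (T : R -> R -> R).

Definition enriched_category (X : Type) (hom : X -> X -> R) : Prop :=
  [/\ forall x y, I01 (hom x y),
      forall x, hom x x = 1
    & forall x y z, T (hom y z) (hom x y) <= hom x z].

Definition enriched_functor (X Y : Type) (homX : X -> X -> R)
    (homY : Y -> Y -> R) (f : X -> Y) : Prop :=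
  forall x x', homX x x' <= homY (f x) (f x').

Definition left_adjoint (X Y : Type) (homX : X -> X -> R)
    (homY : Y -> Y -> R) (f : X -> Y) (g : Y -> X) : Prop :=
  [/\ enriched_functor homX homY f,
      enriched_functor homY homX g
    & forall x y, homY (f x) y = homX x (g y)].

Variables (X : Type) (hom : X -> X -> R).

Definition weight (phi : X -> R) : Prop :=
  (forall x, I01 (phi x)) /\
  (forall x y, hom y x <= residuum T (phi x) (phi y)).

Definition is_colimit (phi : X -> R) (c : X) : Prop :=
  forall x, hom c x =
    inf01 [set residuum T (phi y) (hom y x) | y in [set: X]].

Definition directed_preorder (D : Type) (le : D -> D -> Prop) : Prop :=
  [/\ exists i : D, True,
      forall i, le i i,
      forall i j k, le i j -> le j k -> le i k
    & forall i j, exists2 k, le i k & le j k].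

Definition forward_cauchy (D : Type) (le : D -> D -> Prop) (x : D -> X) :
    Prop :=
  sup [set inf01 [set r | exists j k, [/\ le i j, le j k
                                         & r = hom (x j) (x k)]]
      | i in [set: D]] = 1.

Definition eventual_weight (D : Type) (le : D -> D -> Prop) (x : D -> X)
    (a : X) : R :=
  sup [set inf01 [set hom a (x j) | j in le i] | i in [set: D]].

Definition forward_cauchy_ideal (phi : X -> R) : Prop :=
  weight phi /\
  exists (D : Type) (le : D -> D -> Prop) (x : D -> X),
    [/\ directed_preorder le, forward_cauchy le x
      & phi = eventual_weight le x].

Definition ideals : Type := {phi : X -> R | forward_cauchy_ideal phi}.

Definition ideals_hom (phi1 phi2 : ideals) : R :=
  inf01 [set residuum T (sval phi1 x) (sval phi2 x) | x in [set: X]].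

Definition yoneda_complete : Prop :=
  forall phi, forward_cauchy_ideal phi -> exists c, is_colimit phi c.

(* Colimits are determined only up to isomorphism, so [colim] denotes any
   choice of colimits; whether it has a left adjoint does not depend on the
   choice. *)
Definition continuous_category : Prop :=
  exists colim : ideals -> X,
    (forall phi : ideals, is_colimit (sval phi) (colim phi)) /\
    exists f : X -> ideals, left_adjoint hom ideals_hom f colim.

Definition enriched_domain : Prop :=
  [/\ enriched_category hom, yoneda_complete & continuous_category].

End Enriched.

Section FuzzyNumbers.
Variable R : realType.
Implicit Types (u v : R -> R) (alpha x : R).

Definition upper_semicontinuous u : Prop :=
  forall x a, u x < a -> \forall y \near x, u y < a.

Definition level u alpha : set R :=
  if alpha == 0 then closure [set x | 0 < u x] else [set x | alpha <= u x].

Definition fuzzy_number u : Prop :=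
  (forall x, I01 (u x)) /\
  [/\ exists x0, u x0 = 1,
      forall x y l, I01 l ->
        Num.min (u x) (u y) <= u (l * x + (1 - l) * y),
      upper_semicontinuous u
    & compact (level u 0)].

(* The level sets of a fuzzy number are nonempty compact intervals, so these
   are their endpoints. *)
Definition level_lo u alpha : R := inf (level u alpha).
Definition level_hi u alpha : R := sup (level u alpha).

Definition left_part u x : R :=
  if x < level_lo u 0 then 0 else if x <= level_lo u 1 then u x else 1.

Definition right_part u x : R :=
  if x < level_lo u 1 then 1 else if x <= level_hi u 0 then u x else 0.

Definition fuzzyP (T : R -> R -> R) u v : R :=
  inf01 [set Num.min (residuum T (left_part v x) (left_part u x))
                     (residuum T (right_part u x) (right_part v x))
        | x in [set: R]].

Definition fuzzy_on (M : R) : Type :=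
  {u : R -> R | fuzzy_number u /\ level u 0 `<=` [set` `[- M, M]]}.

Definition fuzzy_on_hom (T : R -> R -> R) (M : R) (u v : fuzzy_on M) : R :=
  fuzzyP T (sval u) (sval v).

End FuzzyNumbers.

(* Main.v *)
Require Import Defs.
From mathcomp Require Import all_boot all_order all_algebra.
From mathcomp Require Import all_classical all_reals all_analysis.
From mathcomp Require Import lra ring.
Set Implicit Arguments.
Unset Strict Implicit.
Unset Printing Implicit Defensive.
Import Order.TTheory GRing.Theory Num.Theory.
Import numFieldNormedType.Exports.
Local Open Scope classical_set_scope.
Local Open Scope ring_scope.

(** Both sides of the equivalence amount to the algebraic condition
    [no_idempotent_square]: no idempotent [e > 0] is the square [T m m] of some
    [m > e].

    On the side of the t-norm, if [T m m = e] with [m > e], then [m -> y <= y]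
    for [y < e] while [m -> e >= m], so the section [m -> -] jumps at [e]; and an
    isomorphism of the block around [m] with the product t-norm would send [m]
    to a number with square 0. Conversely, suppose that [T p s = T p t] lies
    strictly between 0 and [p] although [s < t]. Then [s = T t r] for some
    [r < 1], so this common value is fixed by [r], hence by an idempotent
    ([least_fixing]), which turns out to be a square of something larger. So the
    condition gives cancellation ([T_cancel]), which is exactly what continuity
    of the sections of the residuum asks for.

    On the side of fuzzy numbers, [u] is a pair of monotone profiles with a
    common point of value 1, and the hom-map compares the left profiles
    contravariantly and the right profiles covariantly. A colimit of an ideal is
    computed pointwise, as an infimum of residua on the left and as a supremum
    of products, followed by a regularization, on the right. The two results
    still have a common point of value 1 ([colim_core]), so colimits exist for
    every continuous t-norm, and only continuity of the category distinguishes
    between t-norms.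

    Continuity means that every [u] is approximated by elements absorbed by all
    ideals whose colimit is above [u]. The approximations are obtained by
    shifting the graph of [u] horizontally and vertically by [d > 0]. The net
    converges pointwise to its colimit, and by monotonicity the horizontal shift
    reduces a uniform estimate to finitely many points. The vertical shift of
    the right profile leaves room for the error because [T] is strictly monotone
    where it is positive ([T_strict], [T_strict_uniform]), a consequence of
    cancellation. If, on the contrary, [T m m = e], then the plateau of height
    [m] admits no such approximations: an increasing sequence of plateaus of
    heights [y < e] converges to the one of height [e], and the jump of [m -> -]
    at [e] is not seen by the ideal of that sequence
    ([continuous_no_idempotent_square]). *)

(** * Infima and suprema in the unit interval *)

Section UnitInterval.
Variable R : realType.
Implicit Types (r s x : R) (A : set R).

Lemma I01P x : I01 x <-> 0 <= x <= 1.
Proof. by rewrite /I01 /= in_itv. Qed.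

Lemma I01_intro x : 0 <= x -> x <= 1 -> I01 x.
Proof. by move=> h0 h1; apply/I01P/andP. Qed.

Lemma I01_ge0 x : I01 x -> 0 <= x.
Proof. by move/I01P => /andP[]. Qed.

Lemma I01_le1 x : I01 x -> x <= 1.
Proof. by move/I01P => /andP[]. Qed.

Lemma I01_0 : I01 (0 : R).
Proof. by apply: I01_intro. Qed.

Lemma I01_1 : I01 (1 : R).
Proof. by apply: I01_intro. Qed.

Lemma le_inf01 A r : (forall a, A a -> 0 <= a) ->
  r <= inf01 A <-> r <= 1 /\ forall a, A a -> r <= a.
Proof.
move=> A0; have Alb : has_lbound (1 |` A).
  by exists 0 => a [->//|]; exact: A0.
split=> [rA|[r1 rA]].
  split; first by apply: (le_trans rA); apply: ge_inf => //; left.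
  by move=> a Aa; apply: (le_trans rA); apply: ge_inf => //; right.
apply: lb_le_inf; first by exists 1; left.
by move=> a [->//|]; exact: rA.
Qed.

Lemma inf01_I01 A : (forall a, A a -> 0 <= a) -> I01 (inf01 A).
Proof.
move=> A0; have [[h1 _] h2] := (le_inf01 (inf01 A) A0, le_inf01 0 A0).
by apply: I01_intro; [apply/h2|case: h1].
Qed.

Lemma inf01_lt A r : r <= 1 -> (forall a, A a -> 0 <= a) ->
  inf01 A < r -> exists2 a, A a & a < r.
Proof.
move=> r1 A0 /(inf_lt _) [|a [-> /lt_geF|Aa ar]]; first by exists 1; left.
- by rewrite r1.
- by exists a.
Qed.

Lemma le_sup01 A a : (forall a, A a -> I01 a) -> A a -> a <= sup A.
Proof.
by move=> A1; apply: ub_le_sup; exists 1 => b /A1; exact: I01_le1.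
Qed.

Lemma sup01_le A r : 0 <= r -> (forall a, A a -> a <= r) -> sup A <= r.
Proof.
move=> r0 Ar; have [[a Aa]|A0] := pselect (A !=set0).
  by apply: ge_sup; [exists a|].
suff -> : A = set0 by rewrite sup0.
by rewrite -subset0 => a Aa; apply: A0; exists a.
Qed.

Lemma sup01_I01 A : (forall a, A a -> I01 a) -> I01 (sup A).
Proof.
move=> A1; apply: I01_intro; last by apply: sup01_le => // a /A1/I01_le1.
have [[a Aa]|A0] := pselect (A !=set0).
  by apply: (le_trans _ (le_sup01 A1 Aa)); exact/I01_ge0/A1.
by rewrite sup_out // => -[].
Qed.

Lemma sup01_gt A s : 0 <= s -> s < sup A -> exists2 a, A a & s < a.
Proof.
move=> s0 sA; have [A0|A0] := pselect (A !=set0); first exact: sup_gt.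
by move: sA; rewrite sup_out; [rewrite ltNge s0|case].
Qed.

Lemma le_of_all_lt (a b : R) :
  (forall s, 0 <= s -> s < a -> s <= b) -> 0 <= b -> a <= b.
Proof.
move=> h b0; rewrite leNgt; apply/negP => ba.
have : (a + b) / 2 <= b by apply: h; lra.
by lra.
Qed.

Lemma vanishing_sequence : exists q : nat -> R, [/\ forall i, 0 < q i <= 1,
  forall i j, (i <= j)%N -> q j <= q i & forall e, 0 < e -> exists i, q i < e].
Proof.
exists (fun i => i.+1%:R^-1); split=> [i|i j ij|e e0].
- by rewrite invr_gt0 ltr0n invf_le1 ?ltr0n // ler1n.
- by rewrite lef_pV2 ?posrE ?ltr0n // ler_nat.
- by exists (Num.truncn e^-1); rewrite invf_plt ?posrE ?ltr0n // truncnS_gt.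
Qed.

End UnitInterval.

#[local] Hint Resolve I01_0 I01_1 : core.

(** * Continuous t-norms and their residua *)

Section Tnorm.
Variables (R : realType) (T : R -> R -> R).
Hypothesis hT : continuous_tnorm T.
Implicit Types (a b c e m p q r s t x y z : R).

Lemma T_I01 x y : I01 x -> I01 y -> I01 (T x y).
Proof. by move: x y; case: hT => -[]. Qed.

Lemma T_comm x y : I01 x -> I01 y -> T x y = T y x.
Proof. by move: x y; case: hT => -[]. Qed.

Lemma T_assoc x y z : I01 x -> I01 y -> I01 z -> T x (T y z) = T (T x y) z.
Proof. by move: x y z; case: hT => -[]. Qed.

Lemma T_mono x x' y y' : I01 x -> I01 x' -> I01 y -> I01 y' ->
  x <= x' -> y <= y' -> T x y <= T x' y'.
Proof. by move: x x' y y'; case: hT => -[]. Qed.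

Lemma Tx1 x : I01 x -> T x 1 = x.
Proof. by move: x; case: hT => -[]. Qed.

Lemma T1x x : I01 x -> T 1 x = x.
Proof. by move=> hx; rewrite T_comm // Tx1. Qed.

Lemma T_le_l x y : I01 x -> I01 y -> T x y <= x.
Proof.
by move=> hx hy; rewrite -{2}(Tx1 hx) T_mono //; exact: I01_le1.
Qed.

Lemma T_le_r x y : I01 x -> I01 y -> T x y <= y.
Proof. by move=> hx hy; rewrite T_comm // T_le_l. Qed.

Lemma Tx0 x : I01 x -> T x 0 = 0.
Proof.
move=> hx; apply/eqP; rewrite eq_le T_le_r //=.
exact/I01_ge0/T_I01.
Qed.

Lemma T0x x : I01 x -> T 0 x = 0.
Proof. by move=> hx; rewrite T_comm // Tx0. Qed.

Lemma T_cont a b eps : I01 a -> I01 b -> 0 < eps -> exists2 d, 0 < d &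
  forall a' b', I01 a' -> I01 b' -> `|a - a'| < d -> `|b - b'| < d ->
    `|T a b - T a' b'| < eps.
Proof.
move=> ha hb e0; case: hT => _ /subspace_continuousP /(_ (a, b)) Tc.
have /Tc /cvgrPdist_lt /(_ _ e0) : square01 (a, b) by split.
rewrite near_withinE => /nbhs_ballP [d /= d0 dT]; exists d => // a' b' ha' hb' hd hd'.
by apply: (dT (a', b')); split.
Qed.

(** By monotonicity only lower semicontinuity matters for upper bounds: the
    pairs [(a', b')] have to come close to [(a, b)] from below, and may exceed
    it. *)
Lemma T_approx a b c : I01 a -> I01 b ->
  (forall eps, 0 < eps -> exists a' b', [/\ I01 a', I01 b', a - eps < a',
     b - eps < b' & T a' b' <= c + eps]) -> T a b <= c.
Proof.
move=> ha hb h; rewrite leNgt; apply/negP => cab.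
have e0 : 0 < (T a b - c) / 2 by lra.
have [d d0 hd] := T_cont ha hb e0.
have m0 : 0 < Num.min d ((T a b - c) / 2) by rewrite lt_min d0.
have [a' [b' [ha' hb' aa' bb' hc]]] := h _ m0.
have hm : I01 (Num.min a a') /\ I01 (Num.min b b').
  by split; rewrite minEle; case: ifP.
have md : Num.min d ((T a b - c) / 2) <= d by rewrite ge_min lexx.
have me : Num.min d ((T a b - c) / 2) <= (T a b - c) / 2 by rewrite ge_min lexx orbT.
have : `|T a b - T (Num.min a a') (Num.min b b')| < (T a b - c) / 2.
  apply: hd; [exact: hm.1|exact: hm.2| |];
    rewrite minEle; case: ifP => hh; rewrite ltr_norml; lra.
have : T (Num.min a a') (Num.min b b') <= T a' b'.
  by apply: T_mono => //; [exact: hm.1|exact: hm.2| |]; rewrite ge_min lexx orbT.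
by rewrite ltr_norml; lra.
Qed.

Lemma T_approx_l a b c : I01 a -> I01 b -> 0 <= c ->
  (forall s, 0 <= s -> s < a -> T s b <= c) -> T a b <= c.
Proof.
move=> ha hb c0 h; apply: T_approx => // eps e0.
have := I01_le1 ha; have := I01_ge0 ha => a0 a1.
have [->|an0] := eqVneq a 0; first by exists 0, b; split => //; rewrite ?T0x//; lra.
have m0 : 0 < Num.min eps a by rewrite lt_min e0 lt_def an0.
have m1 : Num.min eps a <= eps by rewrite ge_min lexx.
have m2 : Num.min eps a <= a by rewrite ge_min lexx orbT.
exists (a - Num.min eps a / 2), b; split => //; try lra.
  by apply: I01_intro; lra.
by apply: (@le_trans _ _ c); [apply: h|]; lra.
Qed.

(** ** The residuum *)

Lemma residuum_I01 x y : I01 (residuum T x y).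
Proof. by apply: sup01_I01 => t []. Qed.

Lemma le_residuum x y z : I01 x -> 0 <= y -> I01 z ->
  z <= residuum T x y <-> T x z <= y.
Proof.
move=> hx hy hz; split=> [zr|]; last first.
  by move=> xz; apply: le_sup01 => // t [].
rewrite T_comm //; apply: T_approx_l => // s s0 sz.
have [t [ht xt] st] := sup01_gt s0 (lt_le_trans sz zr).
have hs : I01 s by apply: I01_intro => //; move: (I01_le1 hz); lra.
by apply: le_trans xt; rewrite [leLHS]T_comm // T_mono // ltW.
Qed.

Lemma T_residuum x y : I01 x -> 0 <= y -> T x (residuum T x y) <= y.
Proof. by move=> hx y0; apply/le_residuum => //; exact: residuum_I01. Qed.

(** Divisibility, which is where continuity of a t-norm enters its algebra. *)
Lemma T_residuum_eq x y : I01 x -> 0 <= y -> y <= x -> T x (residuum T x y) = y.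
Proof.
move=> hx y0 yx; have hr := residuum_I01 x y; have x1 := I01_le1 hx.
apply/eqP; rewrite eq_le T_residuum //= leNgt; apply/negP => lty.
have r1 : residuum T x y < 1.
  rewrite lt_def (I01_le1 hr) andbT; apply/eqP => r1.
  by move: lty; rewrite -r1 Tx1 // ltNge yx.
have e0 : 0 < y - T x (residuum T x y) by lra.
have [d d0 hd] := T_cont hx hr e0.
have m0 : 0 < Num.min d (1 - residuum T x y) by rewrite lt_min d0; lra.
have m1 : Num.min d (1 - residuum T x y) <= d by rewrite ge_min lexx.
have m2 : Num.min d (1 - residuum T x y) <= 1 - residuum T x y by rewrite ge_min lexx orbT.
set t := residuum T x y + Num.min d (1 - residuum T x y) / 2.
have ht : I01 t by apply: I01_intro; have := I01_ge0 hr; rewrite /t; lra.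
have : `|T x (residuum T x y) - T x t| < y - T x (residuum T x y).
  by apply: hd; rewrite // ?subrr ?normr0 // ltr_norml /t; lra.
rewrite ltr_norml => /andP[h _].
have : t <= residuum T x y by apply/le_residuum => //; lra.
by rewrite /t; lra.
Qed.

(** ** Cancellation and strict monotonicity *)

(** The infimum [e] of the elements fixing [y] still fixes [y] by continuity,
    hence so does [T e e], and minimality makes [e] idempotent. This replaces
    the limit of the powers of an element that fixes [y]. *)
Lemma least_fixing y : I01 y ->
  exists e, [/\ idempotent_elt T e, T y e = y
    & forall w, I01 w -> T y w = y -> e <= w].
Proof.
move=> hy; pose W := [set w | I01 w /\ T y w = y].
have W0 w : W w -> 0 <= w by case=> /I01_ge0.
have he : I01 (inf01 W) := inf01_I01 W0.
have leW w : W w -> inf01 W <= w.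
  by have [/(_ (lexx _))[_ h _]] := le_inf01 (inf01 W) W0; exact: h.
set e := inf01 W in he leW *.
have ye : T y e = y.
  apply/eqP; rewrite eq_le T_le_l //=.
  rewrite leNgt; apply/negP => lty.
  have e0 : 0 < y - T y e by lra.
  have [d d0 hd] := T_cont hy he e0.
  have [le1|lt1] := leP 1 e.
    by move: lty; rewrite (_ : e = 1) ?Tx1 ?ltxx //; have := I01_le1 he; lra.
  have m0 : 0 < Num.min d (1 - e) by rewrite lt_min d0; lra.
  have m1 : Num.min d (1 - e) <= d by rewrite ge_min lexx.
  have m2 : Num.min d (1 - e) <= 1 - e by rewrite ge_min lexx orbT.
  have [||w [hw yw] lew] := @inf01_lt _ W (e + Num.min d (1 - e) / 2) _ W0.
  - by lra.
  - by rewrite -/e; lra.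
  have ew := leW w (conj hw yw).
  have : `|T y e - T y w| < y - T y e.
    by apply: hd; rewrite // ?subrr ?normr0 // ltr_norml; lra.
  by rewrite yw ltr_norml; lra.
exists e; split=> //; last by move=> w hw yw; exact: leW.
split=> //; apply/eqP; rewrite eq_le T_le_l //=.
apply: leW; split; first exact: T_I01.
by rewrite T_assoc // !ye.
Qed.

Lemma fixed_idempotent a y : I01 a -> I01 y -> T y a = y ->
  exists e, [/\ idempotent_elt T e, y <= e & e <= a].
Proof.
move=> ha hy ya; have [e [ide ye le_e]] := least_fixing hy.
exists e; split=> //; last exact: le_e.
by case: ide => he _; rewrite -ye T_le_r.
Qed.

(** In the ordinal sum decomposition of [T], this excludes a nilpotent summand
    with a positive lower end. *)
Definition no_idempotent_square : Prop :=
  forall e m, idempotent_elt T e -> 0 < e -> I01 m -> e < m -> T m m <> e.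

Lemma T_idem_le e x y : idempotent_elt T e -> I01 x -> I01 y -> e <= x -> e <= y -> e <= T x y.
Proof. by move=> [he ee] hx hy ex ey; rewrite -ee T_mono. Qed.

(** By divisibility [x = T e z], and [e] absorbs into itself. *)
Lemma T_idem_absorb e x : idempotent_elt T e -> I01 x -> x <= e -> T x e = x.
Proof.
move=> [he ee] hx xe; have x0 := I01_ge0 hx; have hr := residuum_I01 e x.
rewrite -(T_residuum_eq he x0 xe) T_comm //; last exact: T_I01.
by rewrite T_assoc // ee.
Qed.

Hypothesis noT : no_idempotent_square.

(** If [s < t], write [s = T t r]. The value [T p t] is fixed by [r], hence
    by an idempotent [e] with [T p t <= e <= r]. Such an [e] cannot be above [t],
    where it would give [s = t], nor above [p], where it would give
    [T p t = p]; so it is the value itself, and the square of [min p t]. *)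
Lemma T_cancel p s t : I01 p -> I01 s -> I01 t ->
  0 < T p t -> T p t < p -> T p s = T p t -> t <= s.
Proof.
move=> hp hs ht y0 yp pst; rewrite leNgt; apply/negP => lst.
have hr := residuum_I01 t s.
have sE : T t (residuum T t s) = s.
  by apply: T_residuum_eq => //; [exact: I01_ge0|exact: ltW].
set r := residuum T t s in hr sE.
have hy : I01 (T p t) by exact: T_I01.
have [|e [ide ye er]] := @fixed_idempotent r (T p t) hr hy.
  by rewrite -T_assoc // sE.
have [he ee] := ide.
have [te|et] := leP t e.
  have : t <= s by rewrite -(T_idem_absorb ide ht te) -sE T_mono.
  by rewrite leNgt lst.
have [pe|ep] := leP p e.
  have : p <= T p t by rewrite -{1}(T_idem_absorb ide hp pe) T_mono // ltW.
  by rewrite leNgt yp.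
have eE : T p t = e.
  by apply/eqP; rewrite eq_le ye; apply: T_idem_le => //; exact: ltW.
pose m := Num.min p t.
have hm : I01 m by rewrite /m minEle; case: ifP.
have em : e < m by rewrite lt_min ep et.
apply: (noT ide _ hm em); first by rewrite -eE.
apply/eqP; rewrite eq_le; apply/andP; split; last by apply: T_idem_le => //; exact: ltW.
by rewrite -eE; apply: T_mono => //; rewrite ge_min lexx ?orbT.
Qed.

(** Without strictness, [T_cancel] applied in each variable leaves only the
    case [q' = r' = T q r], an idempotent that is the square of [min q r]. *)
Lemma T_strict q' q r' r : I01 q' -> I01 q -> I01 r' -> I01 r ->
  q' < q -> r' < r -> 0 < T q' r' -> T q' r' < T q r.
Proof.
move=> hq' hq hr' hr ltq ltr y0; rewrite ltNge; apply/negP => le1.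
have le2 : T q' r' <= T q' r by apply: T_mono => //; exact: ltW.
have le3 : T q' r <= T q r by apply: T_mono => //; exact: ltW.
have le4 : T q' r' <= T q r' by apply: T_mono => //; exact: ltW.
have le5 : T q r' <= T q r by apply: T_mono => //; exact: ltW.
have e1 : T q' r' = T q' r by lra.
have e2 : T r' q' = T r' q by rewrite T_comm // [RHS]T_comm //; lra.
have q'E : T q' r' = q'.
  apply/eqP; rewrite eq_le T_le_l //= leNgt; apply/negP => lty.
  have : r <= r' by apply: (@T_cancel q'); rewrite -?e1.
  by lra.
have r'E : T q' r' = r'.
  apply/eqP; rewrite eq_le T_le_r //= leNgt; apply/negP => lty.
  have : q <= q' by apply: (@T_cancel r') => //; rewrite -e2 T_comm.
  by lra.
have qr : r' = q' by rewrite -r'E.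
have idq : idempotent_elt T q' by split=> //; rewrite -{2}qr.
pose m := Num.min q r.
have hm : I01 m by rewrite /m minEle; case: ifP.
have em : q' < m by rewrite lt_min ltq -qr.
apply: (noT idq _ hm em); first by rewrite -q'E.
apply/eqP; rewrite eq_le; apply/andP; split; last by apply: T_idem_le => //; exact: ltW.
rewrite -[leRHS]q'E; apply: le_trans le1.
by apply: T_mono => //; rewrite ge_min lexx ?orbT.
Qed.

(** A uniform version over [q], obtained by comparing [T] on a finite grid:
    [h] is the mesh and [q] lies in the cell between [k h] and [(k + 1) h]. *)
Lemma T_strict_uniform r' r eps : I01 r' -> I01 r -> r' < r -> 0 < eps ->
  exists2 eta, 0 < eta & forall q, I01 q ->
    T (Num.max 0 (q - eps)) r' <= Num.max 0 (T q r - eta).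
Proof.
move=> hr' hr ltr e0; pose h := eps / 2; have h0 : 0 < h by rewrite /h; lra.
have [N hN] : exists N : nat, h^-1 < N%:R by exists (Num.truncn h^-1).+1; exact: truncnS_gt.
pose A k := Num.max 0 (k%:R * h - h).
have hA k : k%:R * h <= 1 -> I01 (A k).
  by move=> k1; apply: I01_intro; rewrite /A ?le_max ?lexx // ge_max; lra.
have [eta et0 heta] : exists2 eta, 0 < eta & forall k : nat, (k <= N)%N -> k%:R * h <= 1 ->
    T (A k) r' = 0 \/ T (A k) r' <= T (k%:R * h) r - eta.
  elim: N {hN} => [|N [eta et0 IH]].
    exists 1 => // k; rewrite leqn0 => /eqP -> _; left.
    by rewrite /A mul0r sub0r (max_idPl _) ?T0x //; lra.
  pose k := N.+1.
  have [k1|k1] := leP (k%:R * h) 1; last first.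
    exists eta => // k'; rewrite leq_eqVlt => /orP[/eqP -> |]; last exact: IH.
    by rewrite leNgt k1.
  have hk : I01 (k%:R * h) by apply: I01_intro => //; rewrite mulr_ge0 // ltW.
  have [z|nz] := eqVneq (T (A k) r') 0.
    exists eta => // k'; rewrite leq_eqVlt => /orP[/eqP -> _|]; last exact: IH.
    by left.
  have p0 : 0 < T (A k) r' by rewrite lt_def nz I01_ge0 //; apply: T_I01 => //; exact: hA.
  have Ak : A k < k%:R * h.
    rewrite gt_max; apply/andP; split; last by lra.
    by rewrite mulr_gt0 // ltr0n.
  have lt1 := T_strict (hA _ k1) hk hr' hr Ak ltr p0.
  exists (Num.min eta (T (k%:R * h) r - T (A k) r')).
    by rewrite lt_min et0 subr_gt0.
  move=> k'; rewrite leq_eqVlt => /orP[/eqP -> _|k'N k'1].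
    right; rewrite lerBrDr -lerBrDl ge_min lexx orbT //.
  case: (IH k' k'N k'1) => [|le1]; [by left|right].
  apply: (le_trans le1); rewrite lerD2l lerN2 ge_min lexx //.
exists eta => // q hq; have q0 := I01_ge0 hq; have q1 := I01_le1 hq.
pose k := Num.truncn (q / h).
have /andP[] : k%:R <= q / h < k.+1%:R by apply: truncn_itv; rewrite divr_ge0 // ltW.
rewrite ler_pdivlMr // ltr_pdivrMr // => kq qk.
have k1 : k%:R * h <= 1 by lra.
have kN : (k <= N)%N.
  rewrite -(ler_nat R); apply: (@le_trans _ _ h^-1); last exact: ltW.
  by rewrite -[h^-1]mul1r ler_pdivlMr.
have hk : I01 (k%:R * h) by apply: I01_intro => //; rewrite mulr_ge0 // ltW.
have hm : I01 (Num.max 0 (q - eps)).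
  by apply: I01_intro; rewrite ?le_max ?lexx // ge_max; lra.
have leA : T (Num.max 0 (q - eps)) r' <= T (A k) r'.
  apply: T_mono => //; first exact: hA.
  rewrite ge_max le_max lexx /= le_max; apply/orP; right.
  move: qk; rewrite -natr1 mulrDl mul1r => qk.
  have : eps = h + h by rewrite /h; lra.
  by lra.
case: (heta k kN k1) => [z|le1].
  by rewrite z in leA; rewrite le_max leA.
rewrite le_max; apply/orP; right; apply: (le_trans leA); apply: (le_trans le1).
by rewrite lerD2r T_mono.
Qed.

End Tnorm.

(** * The (S) condition *)

Section SCondition.
Variables (R : realType) (T : R -> R -> R).
Hypothesis hT : continuous_tnorm T.
Implicit Types (e m p t y : R).

(** This is half of the jump of [m -> -] at [e = T m m]; the other half is
    that [m -> e >= m]. *)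
Lemma residuum_jump e m y : idempotent_elt T e -> I01 m -> e < m ->
  I01 y -> y < e -> residuum T m y <= y.
Proof.
move=> ide hm em hy ye; have [he _] := ide.
have hr := residuum_I01 T m y.
have mr := T_residuum hT hm (I01_ge0 hy).
have re : residuum T m y < e.
  rewrite ltNge; apply/negP => er.
  have := T_idem_le hT ide hm hr (ltW em) er; lra.
have := T_idem_absorb hT ide hr (ltW re); rewrite T_comm // => <-.
by apply: le_trans mr; apply: T_mono => //; exact: ltW.
Qed.

(** The common consequence of continuity off the diagonal and of continuity of
    the sections: the jump at [e] is excluded. *)
Lemma sections_no_idempotent_square :
  (forall e m, idempotent_elt T e -> 0 < e -> I01 m -> e < m ->
     forall eps, 0 < eps -> exists2 d, 0 < d &
     forall y, I01 y -> `|e - y| < d -> y < m ->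
       `|residuum T m e - residuum T m y| < eps) ->
  no_idempotent_square T.
Proof.
move=> hc e m ide e0 hm em mme.
have em0 : 0 < m - e by lra.
have [he _] := ide.
have [d d0 hd] := hc e m ide e0 hm em _ em0.
have m0 : 0 < Num.min d e by rewrite lt_min d0.
have m1 : Num.min d e <= d by rewrite ge_min lexx.
have m2 : Num.min d e <= e by rewrite ge_min lexx orbT.
pose y := e - Num.min d e / 2.
have hy : I01 y by apply: I01_intro; have := I01_le1 he; rewrite /y; lra.
have ye : y < e by rewrite /y; lra.
have : `|residuum T m e - residuum T m y| < m - e.
  by apply: hd => //; rewrite ?ltr_norml /y; lra.
have := residuum_jump ide hm em hy ye.
have : m <= residuum T m e by apply/le_residuum => //; [exact: ltW|rewrite mme].
by rewrite ltr_norml; lra.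
Qed.

Lemma S_condition_no_idempotent_square : S_condition T -> no_idempotent_square T.
Proof.
case=> [hS e m ide e0 hm em mme|hS|hS].
- have [he ee] := ide.
  have nid : ~ idempotent_elt T m by case=> _ mm; move: em; rewrite -mme mm ltxx.
  have gb : greatest_idempotent_below T m e.
    split=> //; first exact: ltW.
    by move=> e' ide' e'm; rewrite -mme; apply: T_idem_le.
  (* Every idempotent above [m] fixes [m], so the least element fixing [m] is
     the least idempotent above [m]. *)
  have [b [idb mb minb]] := least_fixing hT hm.
  have la : least_idempotent_above T m b.
    split=> //; first by rewrite -{1}mb T_le_r //; case: idb.
    by move=> e' ide' me'; apply: minb; [case: ide'|exact: T_idem_absorb].
  have [phi [[phi01 _ phi_surj] phi_mono phiM]] := hS m e b hm nid gb la e0.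
  have mb' : m <= b by case: la.
  have inm : m \in `[e, b] by rewrite in_itv /= mb' ltW.
  have ine : e \in `[e, b] by rewrite in_itv /= lexx; exact: le_trans (ltW em) mb'.
  have phie : phi e = 0.
    have [z zeb phiz] := phi_surj 0 (I01_0 R).
    have ez : e <= z by move: zeb; rewrite /= in_itv => /andP[].
    apply/eqP; rewrite eq_le -{1}phiz phi_mono // ez /=.
    exact: I01_ge0 (phi01 e ine).
  have := phiM m m inm inm; rewrite mme phie => /esym/eqP.
  rewrite mulf_eq0 orbb => /eqP phim.
  have : m <= e by rewrite -phi_mono // phim phie.
  by lra.
- apply: sections_no_idempotent_square => e m [he ee] e0 hm em eps eps0.
  have nme : m <> e by move=> me; move: em; rewrite me ltxx.
  have /cvgrPdist_lt /(_ _ eps0) := hS m e hm he nme.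
  rewrite near_withinE => /nbhs_ballP [d /= d0 dT]; exists d => // y hy yd _.
  apply: (dT (m, y)); split => //=; first exact: ballxx.
- apply: sections_no_idempotent_square => e m [he ee] e0 hm em eps eps0.
  have m0 : 0 < m <= 1 by rewrite (lt_trans e0 em) (I01_le1 hm).
  have /subspace_continuousP /(_ e) := hS m m0.
  have ein : [set` `[0, m[] e by rewrite /= in_itv /= em ltW.
  move=> /(_ ein) /cvgrPdist_lt /(_ _ eps0).
  rewrite near_withinE => /nbhs_ballP [d /= d0 dT]; exists d => // y hy yd ym.
  by apply: dT => //=; rewrite in_itv /= ym (I01_ge0 hy).
Qed.

(** With [t = p -> y0], one has [T p t = y0]. Continuity from the right only uses
    that [t] is the largest such element; from the left, a [t' < t] with
    [T p t' = y0] would contradict cancellation. *)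
Lemma residuum_section_continuous p y0 eps : no_idempotent_square T ->
  I01 p -> 0 <= y0 -> y0 < p -> 0 < eps -> exists2 d, 0 < d &
  forall y, 0 <= y -> y < p -> `|y0 - y| < d ->
    `|residuum T p y0 - residuum T p y| < eps.
Proof.
move=> hno hp y00 y0p eps0.
have hr := residuum_I01 T p y0; set t := residuum T p y0 in hr *.
have t0 := I01_ge0 hr; have t1 := I01_le1 hr.
have pt : T p t = y0 by apply: T_residuum_eq => //; exact: ltW.
have [d1 d10 up] : exists2 d, 0 < d & forall y, 0 <= y -> y < p -> y < y0 + d ->
    residuum T p y < t + eps.
  have [te|te] := ltP 1 (t + eps).
    exists 1 => // y yy _ _; apply: le_lt_trans te; exact/I01_le1/residuum_I01.
  pose t' := t + eps / 2.
  have ht' : I01 t' by apply: I01_intro; rewrite /t'; lra.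
  have lt1 : y0 < T p t'.
    rewrite ltNge; apply/negP => /(le_residuum hT hp y00 ht'); rewrite -/t /t'; lra.
  exists (T p t' - y0); first by lra.
  move=> y yy _ ylt; apply: (@le_lt_trans _ _ t'); last by rewrite /t'; lra.
  rewrite leNgt; apply/negP => /ltW /(le_residuum hT hp yy ht'); lra.
have [d2 d20 lo] : exists2 d, 0 < d & forall y, 0 <= y -> y < p -> y0 - d < y ->
    t - eps < residuum T p y.
  have [te|te] := ltP (t - eps) 0.
    exists 1 => // y yy _ _; apply: (lt_le_trans te); exact/I01_ge0/residuum_I01.
  pose t' := t - eps / 2.
  have ht' : I01 t' by apply: I01_intro; rewrite /t'; lra.
  suff [d d0 hd] : exists2 d, 0 < d & forall y, 0 <= y -> y0 - d < y -> T p t' <= y.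
    exists d => // y yy _ dy; apply: (@lt_le_trans _ _ t'); first by rewrite /t'; lra.
    by apply/le_residuum => //; exact: hd.
  have le1 : T p t' <= y0 by rewrite -pt T_mono // /t'; lra.
  have [lt1|ge1] := ltP (T p t') y0.
    exists (y0 - T p t'); first by lra.
    by move=> y _ h; lra.
  have e1 : T p t' = T p t by lra.
  have [z|nz] := eqVneq y0 0.
    by exists 1 => // y yy _; rewrite e1 pt z.
  have : t <= t'.
    by apply: (T_cancel hT hno hp ht' hr) => //; rewrite pt // lt_def nz.
  by rewrite /t'; lra.
exists (Num.min d1 d2); first by rewrite lt_min d10.
move=> y yy yp; rewrite lt_min => /andP[].
rewrite !ltr_norml -/t => /andP[b1 _] /andP[_ b2].
have lt1 : residuum T p y < t + eps by apply: up => //; lra.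
have lt2 : t - eps < residuum T p y by apply: lo => //; lra.
by apply/andP; split; lra.
Qed.

Lemma no_idempotent_square_S_condition : no_idempotent_square T -> S_condition T.
Proof.
move=> hno; apply: Or33 => p /andP[p0 p1].
have hp : I01 p by apply: I01_intro => //; exact: ltW.
apply/subspace_continuousP => y0; rewrite /= in_itv /= => /andP[y00 y0p].
apply/cvgrPdist_lt => eps eps0; rewrite near_withinE; apply/nbhs_ballP.
have [d d0 hd] := residuum_section_continuous hno hp y00 y0p eps0.
by exists d => // y /= yd; rewrite in_itv /= => /andP[yy yp]; exact: hd.
Qed.

End SCondition.

(** * Nets, ideals and colimits in an enriched category *)

Definition net_eventually (D : Type) (le : D -> D -> Prop) (P : D -> Prop) : Prop :=
  exists i, forall j, le i j -> P j.

Section Eventually.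
Variables (D : Type) (le : D -> D -> Prop).
Hypothesis hle : directed_preorder le.
Implicit Types P Q : D -> Prop.

Lemma eventually_and P Q : net_eventually le P -> net_eventually le Q ->
  net_eventually le (fun j => P j /\ Q j).
Proof.
case: hle => _ _ tr dir [i Pi] [j Qj]; have [k ik jk] := dir i j.
by exists k => l kl; split; [apply: Pi|apply: Qj]; apply: tr kl.
Qed.

Lemma eventually_exists P : net_eventually le P -> exists j, P j.
Proof. by case: hle => _ rf _ _ [i Pi]; exists i; apply: Pi. Qed.

Lemma eventually_imply P Q : (forall j, P j -> Q j) ->
  net_eventually le P -> net_eventually le Q.
Proof. by move=> PQ [i Pi]; exists i => j /Pi/PQ. Qed.

Lemma eventually_forall_leq (P : nat -> D -> Prop) (N : nat) :
  (forall k, (k <= N)%N -> net_eventually le (P k)) ->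
  net_eventually le (fun j => forall k, (k <= N)%N -> P k j).
Proof.
elim: N => [h|N IH h].
  apply: eventually_imply (h 0%N (leqnn _)) => j Pj k.
  by rewrite leqn0 => /eqP ->.
have h1 := IH (fun k kN => h k (leqW kN)).
apply: eventually_imply (eventually_and h1 (h _ (leqnn _))) => j [Pj PSj] k.
by rewrite leq_eqVlt => /orP[/eqP -> //|]; exact: Pj.
Qed.

End Eventually.

Section Enriched.
Variables (R : realType) (T : R -> R -> R).
Hypothesis hT : continuous_tnorm T.
Variables (X : Type) (hom : X -> X -> R).
Hypothesis hX : enriched_category T hom.
Implicit Types (a c u v x y z : X) (r s : R) (phi psi : X -> R).

Lemma hom_I01 x y : I01 (hom x y).
Proof. by case: hX. Qed.

Lemma homxx x : hom x x = 1.
Proof. by case: hX. Qed.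

Lemma hom_comp x y z : T (hom y z) (hom x y) <= hom x z.
Proof. by case: hX. Qed.

Hint Resolve hom_I01 : core.

Lemma hom_comp1l x y z : hom y z = 1 -> hom x y <= hom x z.
Proof. by move=> yz; rewrite -[hom x y](T1x hT) // -yz hom_comp. Qed.

Section Net.
Variables (D : Type) (le : D -> D -> Prop) (n : D -> X).
Hypothesis hle : directed_preorder le.

Lemma eventual_weight_I01 a : I01 (eventual_weight hom le n a).
Proof.
apply: sup01_I01 => r [i _ <-]; apply: inf01_I01 => s [j _ <-].
exact: I01_ge0.
Qed.

Lemma eventual_weight_gt a s : 0 <= s -> s < eventual_weight hom le n a ->
  net_eventually le (fun j => s <= hom a (n j)).
Proof.
move=> s0 /(sup01_gt s0)[r [i _ <-] /ltW sr]; exists i => j ij.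
have /le_inf01[] := sr; first by move=> r' [k _ <-]; exact: I01_ge0.
by move=> _; apply; exists j.
Qed.

Lemma le_eventual_weight a s : s <= 1 ->
  net_eventually le (fun j => s <= hom a (n j)) -> s <= eventual_weight hom le n a.
Proof.
move=> s1 [i hi].
have h0 k r : [set hom a (n j) | j in le k] r -> 0 <= r.
  by case=> j _ <-; exact: I01_ge0.
apply: (@le_trans _ _ (inf01 [set hom a (n j) | j in le i])).
  apply/le_inf01; first exact: h0.
  by split=> // r [j ij <-]; exact: hi.
apply: le_sup01; last by exists i.
by move=> r [k _ <-]; apply: inf01_I01; exact: h0.
Qed.

Lemma eventual_weight_comp x y :
  T (eventual_weight hom le n x) (hom y x) <= eventual_weight hom le n y.
Proof.
have hw := eventual_weight_I01.
apply: (T_approx_l hT) => //; first exact/I01_ge0.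
move=> s s0 sx; have hs : I01 s.
  by apply: I01_intro => //; move: (I01_le1 (hw x)); lra.
apply: le_eventual_weight; first by apply: I01_le1; exact: T_I01.
apply: eventually_imply (eventual_weight_gt s0 sx) => j sj.
apply: le_trans (hom_comp y x (n j)).
by apply: T_mono.
Qed.

Lemma eventual_weight_weight : weight T hom (eventual_weight hom le n).
Proof.
split=> [|x y]; first exact: eventual_weight_I01.
apply/(le_residuum hT) => //; [exact: eventual_weight_I01|
  exact/I01_ge0/eventual_weight_I01|exact: eventual_weight_comp].
Qed.

End Net.

(** The properties of the net behind a forward Cauchy ideal that are used:
    strict lower bounds of the weight are eventually attained along the net,
    and the net eventually lies in the weight. *)
Definition represents (D : Type) (le : D -> D -> Prop) (n : D -> X) phi : Prop :=
  [/\ directed_preorder le,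
      forall a s, 0 <= s -> s < phi a -> net_eventually le (fun j => s <= hom a (n j)),
      forall a s, s <= 1 -> net_eventually le (fun j => s <= hom a (n j)) -> s <= phi a
    & forall s, 0 <= s -> s < 1 -> net_eventually le (fun j => s <= phi (n j))].

Lemma ideal_represents phi : forward_cauchy_ideal T hom phi ->
  exists (D : Type) (le : D -> D -> Prop) (n : D -> X), represents le n phi.
Proof.
case=> _ [D [le [n [hle fc ->]]]]; exists D, le, n; split=> //.
- by move=> a s; exact: eventual_weight_gt.
- by move=> a s; exact: le_eventual_weight.
- move=> s s0; rewrite -{1}fc => /(sup01_gt s0)[r [i _ <-] /ltW sr].
  exists i => j ij; apply: le_eventual_weight.
    apply: (le_trans sr); apply: I01_le1; apply: inf01_I01.
    by move=> t [k [l [_ _ ->]]]; exact: I01_ge0.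
  exists j => k jk; have /le_inf01[] := sr.
    by move=> t [k' [l [_ _ ->]]]; exact: I01_ge0.
  by move=> _; apply; exists j, k.
Qed.

Lemma ideal_I01 phi x : forward_cauchy_ideal T hom phi -> I01 (phi x).
Proof. by case=> -[]. Qed.

Lemma ideal_comp phi x y : forward_cauchy_ideal T hom phi ->
  T (phi x) (hom y x) <= phi y.
Proof.
move=> hphi; have [[h01 hw] _] := hphi.
by apply/(le_residuum hT) => //; exact: I01_ge0.
Qed.

(** ** Increasing sequences *)

Section IncreasingSequence.
Variable n : nat -> X.
Hypothesis n_incr : forall i j, (i <= j)%N -> hom (n i) (n j) = 1.
Let leN (i j : nat) : Prop := (i <= j)%N.

Let leN_directed : directed_preorder leN.
Proof.
split; [by exists 0%N|by move=> i; exact: leqnn| |].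
- by move=> i j k; exact: leq_trans.
- by move=> i j; exists (maxn i j); rewrite /leN ?leq_maxl ?leq_maxr.
Qed.

Definition sequence_weight : X -> R := eventual_weight hom leN n.

Lemma sequence_weight_ideal : forward_cauchy_ideal T hom sequence_weight.
Proof.
split; first exact: eventual_weight_weight.
exists nat, leN, n; split=> //.
have h (k : nat) : inf01 [set r | exists j l, [/\ leN k j, leN j l & r = hom (n j) (n l)]] = 1.
  have h0 r : (exists j l, [/\ leN k j, leN j l & r = hom (n j) (n l)]) -> 0 <= r.
    by case=> j [l [_ _ ->]]; exact: I01_ge0.
  apply/eqP; rewrite eq_le I01_le1 /=; last exact: inf01_I01.
  apply/le_inf01 => //; split=> // r [j [l [_ jl ->]]].
  by rewrite n_incr.
apply/eqP; rewrite eq_le; apply/andP; split.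
  by apply: sup01_le => // r [i _ <-]; rewrite h.
apply: le_sup01; last by exists 0%N.
by move=> r [i _ <-]; rewrite h.
Qed.

Lemma le_sequence_weight a i : hom a (n i) <= sequence_weight a.
Proof.
apply: le_eventual_weight; first exact: I01_le1.
by exists i => j ij; apply: hom_comp1l; exact: n_incr.
Qed.

Lemma sequence_weight_gt a s : 0 <= s -> s < sequence_weight a ->
  exists i, s <= hom a (n i).
Proof. by move=> s0 /(eventual_weight_gt s0)/(eventually_exists leN_directed). Qed.

Lemma sequence_weight_self i : sequence_weight (n i) = 1.
Proof.
apply/eqP; rewrite eq_le I01_le1 /=; last exact: eventual_weight_I01.
by rewrite -(homxx (n i)) le_sequence_weight.
Qed.

End IncreasingSequence.

(** ** Colimits and the adjunction *)

Lemma inf_residuum_ge0 (f g : X -> R) r :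
  [set residuum T (f y) (g y) | y in [set: X]] r -> 0 <= r.
Proof. by case=> y _ <-; exact/I01_ge0/residuum_I01. Qed.

Lemma le_inf_residuum (f g : X -> R) r : I01 r ->
  (forall y, I01 (f y)) -> (forall y, I01 (g y)) ->
  r <= inf01 [set residuum T (f y) (g y) | y in [set: X]] <->
  forall y, T (f y) r <= g y.
Proof.
move=> hr hf hg; split.
  move=> /le_inf01 [] => [|_ h y]; first exact: inf_residuum_ge0.
  by apply/(le_residuum hT) => //; [exact: I01_ge0|apply: h; exists y].
move=> h; apply/le_inf01; first exact: inf_residuum_ge0.
split=> [|_ [y _ <-]]; first exact: I01_le1.
by apply/(le_residuum hT) => //; exact: I01_ge0.
Qed.

Lemma eq_I01 (a b : R) : I01 a -> I01 b ->
  (forall r, I01 r -> (r <= a <-> r <= b)) -> a = b.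
Proof.
move=> ha hb h; apply/eqP; rewrite eq_le; apply/andP; split; exact/h.
Qed.

Lemma is_colimitP phi c : (forall y, I01 (phi y)) ->
  is_colimit T hom phi c <->
  forall x r, I01 r -> (r <= hom c x <-> forall y, T (phi y) r <= hom y x).
Proof.
move=> hphi; split=> [h x r hr|h x].
  by rewrite h; apply: le_inf_residuum.
apply: eq_I01 => //; first by apply: inf01_I01; exact: inf_residuum_ge0.
by move=> r hr; rewrite h //; apply: iff_sym; exact: le_inf_residuum.
Qed.

Lemma colimit_unit phi c y : (forall y, I01 (phi y)) ->
  is_colimit T hom phi c -> phi y <= hom y c.
Proof.
move=> hphi /(is_colimitP _ hphi) /(_ c 1 (I01_1 R)) [h _].
by rewrite -[phi y](Tx1 hT) //; apply: h; rewrite homxx.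
Qed.

Lemma colimit_unique phi c c' : (forall y, I01 (phi y)) ->
  is_colimit T hom phi c -> is_colimit T hom phi c' -> hom c c' = 1.
Proof.
move=> hphi hc hc'; apply/eqP; rewrite eq_le I01_le1 //=.
have /(is_colimitP _ hphi) h := hc; apply/h => // y.
by rewrite (Tx1 hT) //; exact: colimit_unit.
Qed.

Lemma ideals_homP (phi psi : ideals T hom) r : I01 r ->
  r <= ideals_hom phi psi <-> forall x, T (sval phi x) r <= sval psi x.
Proof.
move=> hr; apply: (@le_inf_residuum (sval phi) (sval psi)) => // y.
  exact/ideal_I01/(svalP phi).
exact/ideal_I01/(svalP psi).
Qed.

Lemma ideals_hom_I01 (phi psi : ideals T hom) : I01 (ideals_hom phi psi).
Proof. by apply: inf01_I01; exact: inf_residuum_ge0. Qed.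

Lemma ideals_homxx (phi : ideals T hom) : ideals_hom phi phi = 1.
Proof.
apply/eqP; rewrite eq_le I01_le1 /=; last exact: ideals_hom_I01.
by apply/ideals_homP => // x; rewrite (Tx1 hT) //; exact/ideal_I01/(svalP phi).
Qed.

(** A left adjoint to [colim] only has to be given on objects: it is then
    automatically a functor. *)
Lemma continuous_category_intro :
  yoneda_complete T hom ->
  (forall u, exists2 psi : X -> R, forward_cauchy_ideal T hom psi &
     forall phi c r, forward_cauchy_ideal T hom phi -> is_colimit T hom phi c -> I01 r ->
       r <= hom u c <-> forall x, T (psi x) r <= phi x) ->
  continuous_category T hom.
Proof.
move=> yc hu.
have /choice[colim hcolim] : forall phi : ideals T hom, exists c, is_colimit T hom (sval phi) c.
  by move=> phi; exact/yc/(svalP phi).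
have hphi (phi : ideals T hom) y : I01 (sval phi y) by exact/ideal_I01/(svalP phi).
have /choice[f hf] : forall u, exists psi : ideals T hom, forall phi : ideals T hom,
    ideals_hom psi phi = hom u (colim phi).
  move=> u; have [psi hpsi h] := hu u; exists (exist _ psi hpsi) => phi.
  apply: eq_I01 => [||r hr]; [exact: ideals_hom_I01|by []|].
  rewrite ideals_homP //; apply: iff_sym; apply: h => //.
  exact: (svalP phi).
exists colim; split=> //; exists f; split=> //.
- move=> u v; rewrite hf; apply: hom_comp1l.
  by rewrite -hf ideals_homxx.
- move=> phi psi; have /(is_colimitP _ (hphi phi)) h := hcolim phi.
  apply/h; first exact: ideals_hom_I01.
  move=> y; apply: (@le_trans _ _ (sval psi y)).
    by move: y; apply/ideals_homP => //; exact: ideals_hom_I01.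
  exact: colimit_unit.
Qed.

(** Approximating [u] from below by an increasing sequence that every ideal
    whose colimit is above [u] absorbs gives the value of the left adjoint. *)
Lemma sequence_way_below (n : nat -> X) u :
  (forall i j, (i <= j)%N -> hom (n i) (n j) = 1) ->
  (forall phi c i, forward_cauchy_ideal T hom phi -> is_colimit T hom phi c ->
     hom u c <= phi (n i)) ->
  (forall c r, I01 r -> (forall i, r <= hom (n i) c) -> r <= hom u c) ->
  forall phi c r, forward_cauchy_ideal T hom phi -> is_colimit T hom phi c -> I01 r ->
    r <= hom u c <-> forall x, T (sequence_weight n x) r <= phi x.
Proof.
move=> n_incr absorb dense phi c r hphi hc hr.
have phi01 y : I01 (phi y) by exact: ideal_I01.
split=> [rc x|h].
  apply: (T_approx_l hT) => //; [exact: eventual_weight_I01|exact: I01_ge0|].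
  move=> s s0 sx; have [i si] := sequence_weight_gt s0 sx.
  apply: le_trans (ideal_comp (n i) x hphi).
  rewrite [leRHS](T_comm hT) //; apply: (T_mono hT) => //.
    by apply: I01_intro => //; apply: (le_trans si); exact: I01_le1.
  exact: le_trans rc (absorb _ _ _ hphi hc).
apply: dense => // i; apply: le_trans (colimit_unit (n i) phi01 hc).
by rewrite -[r](T1x hT) // -(sequence_weight_self n_incr i).
Qed.

End Enriched.

(** * Fuzzy numbers as pairs of monotone profiles *)

(** For monotone functions upper semicontinuity is one-sided continuity, which
    the third fields express without limits. *)
Record left_profile (R : realType) (M : R) (f : R -> R) : Prop := LeftProfile {
  left_I01 : forall x : R, I01 (f x);
  left_mono : forall x y : R, x <= y -> f x <= f y;
  left_rcont : forall x a : R, f x < a -> exists2 d : R, 0 < d & f (x + d) < a;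
  left_before : forall x : R, x < - M -> f x = 0;
  left_after : forall x : R, M <= x -> f x = 1 }.

Record right_profile (R : realType) (M : R) (g : R -> R) : Prop := RightProfile {
  right_I01 : forall x : R, I01 (g x);
  right_anti : forall x y : R, x <= y -> g y <= g x;
  right_lcont : forall x a : R, g x < a -> exists2 d : R, 0 < d & g (x - d) < a;
  right_after : forall x : R, M < x -> g x = 0;
  right_before : forall x : R, x <= - M -> g x = 1 }.

Section FromFuzzy.
Variables (R : realType) (M : R) (u : R -> R).
Hypothesis hu : fuzzy_number u.
Hypothesis hM : level u 0 `<=` [set` `[- M, M]].
Let lo := level_lo u 1.

Let u01 x : I01 (u x).
Proof. by case: hu. Qed.

Let supp x : 0 < u x -> - M <= x <= M.
Proof.
move=> ux; have : level u 0 x by rewrite /level eqxx; exact: subset_closure.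
by move/hM; rewrite /= in_itv.
Qed.

Let level1 : level u 1 = [set x | 1 <= u x].
Proof. by rewrite /level oner_eq0. Qed.

Let lo_le x : 1 <= u x -> lo <= x.
Proof.
move=> ux; apply: ge_inf; last by rewrite level1.
exists (- M) => y; rewrite level1 /= => uy.
by have /andP[] : - M <= y <= M by apply: supp; lra.
Qed.

Let lo_adherent e : 0 < e -> exists2 x, 1 <= u x & x < lo + e.
Proof.
move=> e0; have lt1 : lo < lo + e by lra.
have [|//|x] := @inf_lt _ (level u 1) (lo + e).
- by case: hu => _ [[x0 ux0] _ _ _]; exists x0; rewrite level1 /= ux0.
- by rewrite level1 => ux xl; exists x.
Qed.

Let usc x a : u x < a -> exists2 d, 0 < d & forall y, `|x - y| < d -> u y < a.
Proof.
case: hu => _ [_ _ us _] /us /nbhs_ballP [d /= d0 hd].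
by exists d => // y xy; exact: hd.
Qed.

Let u_lo : u lo = 1.
Proof.
apply/eqP; rewrite eq_le I01_le1 //= leNgt; apply/negP => /usc[d d0 hd].
have [x ux xd] := lo_adherent d0.
have : u x < 1 by apply: hd; have := lo_le ux; rewrite ltr_norml; lra.
lra.
Qed.

Let quasiconcave x y z : x <= y -> y <= z -> Num.min (u x) (u z) <= u y.
Proof.
move=> xy yz; have [xz|xz] := eqVneq x z.
  have -> : y = x by apply/eqP; rewrite eq_le xy andbT xz.
  by rewrite ge_min lexx.
have xz' : 0 < z - x by rewrite subr_gt0 lt_def eq_sym xz (le_trans xy).
case: hu => _ [_ qc _ _].
have hl : I01 ((z - y) / (z - x)).
  by apply: I01_intro; rewrite ?ler_pdivrMr ?divr_ge0 //; lra.
have yE : y = (z - y) / (z - x) * x + (1 - (z - y) / (z - x)) * z.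
  by field; rewrite gt_eqF.
rewrite [X in _ <= u X]yE; exact: qc.
Qed.

Let left_partE x : left_part u x = if x <= lo then u x else 1.
Proof.
rewrite /left_part -/lo; case: ifP => // xl.
have u0 y : 0 < u y -> level_lo u 0 <= y.
  move=> uy; apply: ge_inf; last by rewrite /level eqxx; exact: subset_closure.
  by exists (- M) => z /hM; rewrite /= in_itv => /andP[].
case: ifP => xlo.
  apply/eqP; rewrite eq_le I01_ge0 //= leNgt; apply/negP => /u0.
  by rewrite leNgt xl.
have /u0 : 0 < u lo by rewrite u_lo.
by move: xlo; lra.
Qed.

Let right_partE x : right_part u x = if x < lo then 1 else u x.
Proof.
rewrite /right_part -/lo; case: ifP => // _; case: ifP => // xh.
apply/eqP; rewrite eq_sym eq_le I01_ge0 // andbT leNgt; apply/negP => ux.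
have : x <= level_hi u 0.
  apply: ub_le_sup; last by rewrite /level eqxx; exact: subset_closure.
  by exists M => z /hM; rewrite /= in_itv => /andP[].
by rewrite xh.
Qed.

Lemma left_part_profile : left_profile M (left_part u).
Proof.
split.
- by move=> x; rewrite left_partE; case: ifP.
- move=> x y xy; rewrite !left_partE; case: ifP => xl; case: ifP => yl //.
  + have := quasiconcave xy yl; rewrite u_lo (min_idPl _) //.
    exact: I01_le1.
  + exact: I01_le1.
  + by have := le_trans xy yl; rewrite xl.
- move=> x a; rewrite left_partE; case: ifP => xl xa; last first.
    exists 1 => //; rewrite left_partE ifF //; apply/negP => h.
    by move: xl; rewrite (le_trans _ h) // lerDl.
  have [lx|ltx] := leP lo x.
    have xE : x = lo by apply/eqP; rewrite eq_le xl.
    exists 1 => //; rewrite left_partE ifF; first by rewrite -u_lo -xE.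
    by rewrite xE; apply/negP; lra.
  have [d d0 hd] := usc xa.
  have m0 : 0 < Num.min d (lo - x) by rewrite lt_min d0; lra.
  have m1 : Num.min d (lo - x) <= d by rewrite ge_min lexx.
  have m2 : Num.min d (lo - x) <= lo - x by rewrite ge_min lexx orbT.
  exists (Num.min d (lo - x) / 2); first by lra.
  rewrite left_partE ifT; last by lra.
  by apply: hd; rewrite ltr_norml; lra.
- move=> x xM; rewrite left_partE; case: ifP => xl.
    apply/eqP; rewrite eq_le I01_ge0 // andbT leNgt; apply/negP => /supp; lra.
  have /supp : 0 < u lo by rewrite u_lo.
  by lra.
- move=> x Mx; rewrite left_partE; case: ifP => // xl.
  have /supp : 0 < u lo by rewrite u_lo.
  move=> /andP[_ lM]; have -> : x = lo by lra.
  exact: u_lo.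
Qed.

Lemma right_part_profile : right_profile M (right_part u).
Proof.
have loM : - M <= lo <= M by apply: supp; rewrite u_lo.
split.
- by move=> x; rewrite right_partE; case: ifP.
- move=> x y xy; rewrite !right_partE; case: (ltP x lo) => xl; case: (ltP y lo) => yl //.
  + exact: I01_le1.
  + by lra.
  + have := quasiconcave xl xy; rewrite u_lo (min_idPr _) //.
    exact: I01_le1.
- move=> x a; rewrite right_partE; case: (ltP x lo) => xl xa.
    by exists 1 => //; rewrite right_partE ifT //; lra.
  move: xl; rewrite le_eqVlt => /orP[/eqP xE|xl].
    exists 1 => //; rewrite right_partE ifT; last by lra.
    by rewrite -u_lo xE.
  have [d d0 hd] := usc xa.
  have m0 : 0 < Num.min d (x - lo) by rewrite lt_min d0; lra.
  have m1 : Num.min d (x - lo) <= d by rewrite ge_min lexx.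
  have m2 : Num.min d (x - lo) <= x - lo by rewrite ge_min lexx orbT.
  exists (Num.min d (x - lo) / 2); first by lra.
  rewrite right_partE ifF; last by apply/negP; lra.
  by apply: hd; rewrite ltr_norml; lra.
- move=> x xM; rewrite right_partE ifF; last by apply/negP; lra.
  apply/eqP; rewrite eq_le I01_ge0 // andbT leNgt; apply/negP => /supp; lra.
- move=> x Mx; rewrite right_partE; case: (ltP x lo) => // xl.
  by have -> : x = lo by lra.
Qed.

Lemma parts_core : exists c, left_part u c = 1 /\ right_part u c = 1.
Proof. by exists lo; rewrite left_partE right_partE lexx ltxx u_lo. Qed.

End FromFuzzy.

Section ToFuzzy.
Variables (R : realType) (M : R) (f g : R -> R) (c : R).
Hypotheses (hf : left_profile M f) (hg : right_profile M g).
Hypotheses (fc : f c = 1) (gc : g c = 1).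
Let u x := Num.min (f x) (g x).

Let u01 x : I01 (u x).
Proof.
by rewrite /u minEle; case: ifP => _; [exact: left_I01 hf x|exact: right_I01 hg x].
Qed.

Let supp x : 0 < u x -> - M <= x <= M.
Proof.
rewrite lt_min => /andP[fx gx]; apply/andP; split; rewrite leNgt; apply/negP.
  by move/(left_before hf) => f0; rewrite f0 ltxx in fx.
by move/(right_after hg) => g0; rewrite g0 ltxx in gx.
Qed.

Let level0 : level u 0 `<=` [set` `[- M, M]].
Proof.
rewrite /level eqxx.
have /closure_id -> : closed [set` `[- M, M]] by exact: interval_closed.
by apply: closureS => x /supp; rewrite /= in_itv.
Qed.

Let u_fuzzy : fuzzy_number u.
Proof.
split; first exact: u01.
split.
- by exists c; rewrite /u fc gc minxx.
- move=> x y l hl; have l0 := I01_ge0 hl; have l1 := I01_le1 hl.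
  set z := l * x + (1 - l) * y.
  wlog xy : x y l hl l0 l1 @z / x <= y.
    move=> h; have [|/ltW yx] := leP x y; first exact: h.
    have -> : z = (1 - l) * y + (1 - (1 - l)) * x by rewrite /z; ring.
    by rewrite minC; apply: h => //; try lra; apply: I01_intro; lra.
  have xz : x <= z by rewrite /z; nra.
  have zy : z <= y by rewrite /z; nra.
  have h1 := left_mono hf xz; have h2 := right_anti hg zy.
  rewrite /u !ge_min !le_min /=.
  by case: (leP (f x) (g x)); case: (leP (f y) (g y)) => *; apply/orP; lra.
- move=> x a; rewrite /u gt_min => /orP[/(left_rcont hf)|/(right_lcont hg)] [d d0 hd].
    apply/nbhs_ballP; exists d => //= y; rewrite /ball /= ltr_norml => /andP[xy _].
    rewrite gt_min (le_lt_trans _ hd) //; apply: (left_mono hf); lra.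
  apply/nbhs_ballP; exists d => //= y; rewrite /ball /= ltr_norml => /andP[_ xy].
  rewrite gt_min orbC (le_lt_trans _ hd) //; apply: (right_anti hg); lra.
- apply: subclosed_compact level0; last exact: segment_compact.
  by rewrite /level eqxx; exact: closed_closure.
Qed.

(** The number is [min f g]: to the left of its core [g] is 1 and to the right
    of it [f] is 1, because of the common point [c]. *)
Lemma fuzzy_of_profiles :
  exists u : fuzzy_on M, left_part (sval u) = f /\ right_part (sval u) = g.
Proof.
exists (exist _ u (conj u_fuzzy level0)) => /=.
have level1 : level u 1 = [set x | 1 <= u x] by rewrite /level oner_eq0.
have lo_le x : 1 <= u x -> level_lo u 1 <= x.
  move=> ux; apply: ge_inf; last by rewrite level1.
  exists (- M) => y; rewrite level1 /= => uy.
  by have /andP[] : - M <= y <= M by apply: supp; lra.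
have uc : u c = 1 by rewrite /u fc gc minxx.
have lo_c : level_lo u 1 <= c by apply: lo_le; rewrite uc.
set lo := level_lo u 1 in lo_le lo_c *.
have gE x : x <= lo -> g x = 1.
  move=> xl; apply/eqP; rewrite eq_le (I01_le1 (right_I01 hg _)) /= -gc.
  exact: (right_anti hg) (le_trans xl lo_c).
have f_gt x : lo < x -> f x = 1.
  move=> lx; have [|//|y] := @inf_lt _ (level u 1) x.
    by exists c; rewrite level1 /= uc.
  rewrite level1 /= le_min => /andP[fy _] yx.
  apply/eqP; rewrite eq_le (I01_le1 (left_I01 hf _)) /=.
  by apply: (le_trans fy); apply: (left_mono hf); exact: ltW.
have f_ge x : lo <= x -> f x = 1.
  rewrite le_eqVlt => /orP[/eqP <-|]; last exact: f_gt.
  apply/eqP; rewrite eq_le (I01_le1 (left_I01 hf _)) /= leNgt; apply/negP.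
  move=> /(left_rcont hf)[d d0]; rewrite f_gt ?ltxx //; lra.
have lo0_le x : 0 < u x -> level_lo u 0 <= x.
  move=> ux; apply: ge_inf; last by rewrite /level eqxx; exact: subset_closure.
  by exists (- M) => z /level0; rewrite /= in_itv => /andP[].
have hi0_ge x : 0 < u x -> x <= level_hi u 0.
  move=> ux; apply: ub_le_sup; last by rewrite /level eqxx; exact: subset_closure.
  by exists M => z /level0; rewrite /= in_itv => /andP[].
split; apply/funext => x.
- rewrite /left_part -/lo; case: ifP => xl0; last first.
    case: ifP => xlo.
      by rewrite /u (gE _ xlo) (min_idPl _) //; exact: I01_le1 (left_I01 hf _).
    by rewrite f_gt //; rewrite ltNge xlo.
  apply/eqP; rewrite eq_le (I01_ge0 (left_I01 hf _)) /= leNgt; apply/negP => fx.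
  have [xlo|lox] := leP x lo.
    have /lo0_le : 0 < u x by rewrite /u (gE _ xlo) lt_min fx ltr01.
    by rewrite leNgt xl0.
  have /lo0_le : 0 < u lo by rewrite /u gE // f_ge // minxx.
  by lra.
- rewrite /right_part -/lo; case: ifP => xl0; first by rewrite gE // ltW.
  have lox : lo <= x by rewrite leNgt xl0.
  case: ifP => xh.
    by rewrite /u (f_ge _ lox) (min_idPr _) //; exact: I01_le1 (right_I01 hg _).
  apply/eqP; rewrite eq_le (I01_ge0 (right_I01 hg _)) /= leNgt; apply/negP => gx.
  have /hi0_ge : 0 < u x by rewrite /u (f_ge _ lox) lt_min gx ltr01.
  by rewrite xh.
Qed.

End ToFuzzy.

(** * The enriched category of fuzzy numbers *)

Section FuzzyCategory.
Variables (R : realType) (T : R -> R -> R) (M : R).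
Hypothesis hT : continuous_tnorm T.
Notation X := (fuzzy_on M).
Implicit Types (u v w : X) (r s x : R).

Definition lpart u : R -> R := left_part (sval u).
Definition rpart u : R -> R := right_part (sval u).

Lemma lpartP u : left_profile M (lpart u).
Proof. by case: u => u [hu hM]; exact: left_part_profile. Qed.

Lemma rpartP u : right_profile M (rpart u).
Proof. by case: u => u [hu hM]; exact: right_part_profile. Qed.

Lemma part_core u : exists c, lpart u c = 1 /\ rpart u c = 1.
Proof. by case: u => u [hu hM]; exact: (parts_core hu hM). Qed.

Lemma lpart_I01 u x : I01 (lpart u x).
Proof. exact: left_I01 (lpartP u) x. Qed.

Lemma rpart_I01 u x : I01 (rpart u x).
Proof. exact: right_I01 (rpartP u) x. Qed.

Local Hint Resolve lpart_I01 rpart_I01 : core.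

Let fuzzy_hom_ge0 u v r :
  [set Num.min (residuum T (lpart v x) (lpart u x))
               (residuum T (rpart u x) (rpart v x)) | x in [set: R]] r -> 0 <= r.
Proof. by case=> x _ <-; rewrite le_min !I01_ge0 //; exact: residuum_I01. Qed.

Lemma fuzzy_hom_I01 u v : I01 (fuzzy_on_hom T u v).
Proof. by apply: inf01_I01; exact: fuzzy_hom_ge0. Qed.

Lemma le_fuzzy_hom u v r : I01 r -> r <= fuzzy_on_hom T u v <->
  forall x, T r (lpart v x) <= lpart u x /\ T r (rpart u x) <= rpart v x.
Proof.
move=> hr; split.
  move=> /le_inf01 [] => [|_ h x]; first exact: fuzzy_hom_ge0.
  have := h _ (ex_intro2 _ _ x I erefl); rewrite le_min => /andP[].
  move=> /(le_residuum hT (lpart_I01 v x) (I01_ge0 (lpart_I01 u x)) hr) h1.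
  move=> /(le_residuum hT (rpart_I01 u x) (I01_ge0 (rpart_I01 v x)) hr) h2.
  by split; rewrite (T_comm hT hr).
move=> h; apply/le_inf01; first exact: fuzzy_hom_ge0.
split=> [|_ [x _ <-]]; first exact: I01_le1.
have [h1 h2] := h x.
rewrite le_min; apply/andP.
split.
  apply/(le_residuum hT (lpart_I01 v x) (I01_ge0 (lpart_I01 u x)) hr).
  by rewrite (T_comm hT _ hr).
apply/(le_residuum hT (rpart_I01 u x) (I01_ge0 (rpart_I01 v x)) hr).
by rewrite (T_comm hT _ hr).
Qed.

Lemma fuzzy_hom_lpart u v x : T (fuzzy_on_hom T u v) (lpart v x) <= lpart u x.
Proof.
by have [/(_ (lexx _)) h _] := le_fuzzy_hom u v (fuzzy_hom_I01 u v); case: (h x).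
Qed.

Lemma fuzzy_hom_rpart u v x : T (fuzzy_on_hom T u v) (rpart u x) <= rpart v x.
Proof.
by have [/(_ (lexx _)) h _] := le_fuzzy_hom u v (fuzzy_hom_I01 u v); case: (h x).
Qed.

Lemma fuzzy_enriched_category : enriched_category T (@fuzzy_on_hom R T M).
Proof.
have h01 := fuzzy_hom_I01.
split=> // [u|u v w].
  apply/eqP; rewrite eq_le I01_le1 //=; apply/le_fuzzy_hom => // x.
  by rewrite !(T1x hT).
apply/le_fuzzy_hom => [|x]; first exact: T_I01.
split.
  rewrite (T_comm hT (h01 v w)) // -(T_assoc hT) //.
  apply: le_trans (fuzzy_hom_lpart u v x).
  by apply: (T_mono hT) => //; [exact: T_I01|exact: fuzzy_hom_lpart].
rewrite -(T_assoc hT) //.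
apply: le_trans (fuzzy_hom_rpart v w x).
by apply: (T_mono hT) => //; [exact: T_I01|exact: fuzzy_hom_rpart].
Qed.

End FuzzyCategory.

#[local] Hint Resolve lpart_I01 rpart_I01 : core.

(** * Colimits of ideals of fuzzy numbers *)

Section Colimit.
Variables (R : realType) (T : R -> R -> R) (M : R).
Hypothesis hT : continuous_tnorm T.
Notation X := (fuzzy_on M).
Notation hom := (@fuzzy_on_hom R T M).
Let hX : enriched_category T hom := fuzzy_enriched_category M hT.
Implicit Types (u v w y : X) (r s x : R).

Section Parts.
Variable phi : X -> R.
Hypothesis hphi : forward_cauchy_ideal T hom phi.

Let phi01 y : I01 (phi y).
Proof. exact: ideal_I01 hphi. Qed.
Local Hint Resolve phi01 : core.

Definition colim_left x : R :=
  inf01 [set residuum T (phi y) (lpart y x) | y in [set: X]].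

(** The pointwise supremum need not be left continuous; [colim_right] is its
    upper semicontinuous envelope. *)
Definition presup_right x : R := sup [set T (phi y) (rpart y x) | y in [set: X]].

Definition colim_right x : R := inf01 [set presup_right z | z in [set z | z < x]].

Lemma le_colim_left x r : I01 r ->
  r <= colim_left x <-> forall y, T (phi y) r <= lpart y x.
Proof. by move=> hr; exact: (le_inf_residuum hT (g := fun y => lpart y x)). Qed.

Lemma colim_left_I01 x : I01 (colim_left x).
Proof. by apply: inf01_I01; exact: inf_residuum_ge0. Qed.

Let presup_set x r : [set T (phi y) (rpart y x) | y in [set: X]] r -> I01 r.
Proof. by case=> y _ <-; exact: T_I01. Qed.

Lemma presup_right_I01 x : I01 (presup_right x).
Proof. by apply: sup01_I01; exact: presup_set. Qed.

Lemma le_presup_right x y : T (phi y) (rpart y x) <= presup_right x.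
Proof. by apply: le_sup01; [exact: presup_set|exists y]. Qed.

Lemma presup_right_le x r : 0 <= r ->
  (forall y, T (phi y) (rpart y x) <= r) -> presup_right x <= r.
Proof. by move=> r0 h; apply: sup01_le => // _ [y _ <-]. Qed.

Let colim_right_set x r : [set presup_right z | z in [set z | z < x]] r -> 0 <= r.
Proof. by case=> z _ <-; exact/I01_ge0/presup_right_I01. Qed.

Lemma colim_right_I01 x : I01 (colim_right x).
Proof. by apply: inf01_I01; exact: colim_right_set. Qed.

Lemma le_colim_right x r :
  r <= colim_right x <-> r <= 1 /\ forall z, z < x -> r <= presup_right z.
Proof.
rewrite le_inf01; last exact: colim_right_set.
split=> -[r1 h]; split=> //.
  by move=> z zx; apply: h; exists z.
by move=> _ [z zx <-]; exact: h.
Qed.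

Lemma colim_right_le z x : z < x -> colim_right x <= presup_right z.
Proof. by move=> zx; have /le_colim_right[_ h] := lexx (colim_right x); exact: h. Qed.

Lemma le_colim_right_part y x : T (phi y) (rpart y x) <= colim_right x.
Proof.
apply/le_colim_right; split=> [|z zx]; first by apply: I01_le1; exact: T_I01.
apply: le_trans (le_presup_right z y).
by apply: (T_mono hT) => //; apply: (right_anti (rpartP y)); exact: ltW.
Qed.

(** ** Pointwise convergence of a representing net *)

Section Net.
Variables (D : Type) (le : D -> D -> Prop) (n : D -> X).
Hypothesis hn : represents hom le n phi.

(** Some [y] and some [s < phi y] witness [colim_left x < b]; along the net
    [hom y (n j)] is eventually at least [s], which bounds the left part of
    [n j] at [x]. *)
Lemma eventually_lpart_le x b : colim_left x < b ->
  net_eventually le (fun j => lpart (n j) x <= b).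
Proof.
case: hn => hle gt _ _ xb.
have b0 : 0 < b := le_lt_trans (I01_ge0 (colim_left_I01 x)) xb.
have [b1|b1] := leP b 1; last first.
  have [i _] : exists i : D, True by case: hle.
  by exists i => j _; apply: (le_trans (I01_le1 (lpart_I01 _ _))); exact: ltW.
have hb : I01 b by apply: I01_intro => //; exact: ltW.
have [y /negP] : exists y, ~ T (phi y) b <= lpart y x.
  by apply/existsNP => /(le_colim_left x hb); rewrite leNgt xb.
rewrite -ltNge => lty.
have [s [s0 sy lts]] : exists s, [/\ 0 <= s, s < phi y & lpart y x < T s b].
  apply: contrapT => nex; move: lty; apply/negP; rewrite -leNgt.
  apply: (T_approx_l hT) => //; first exact: I01_ge0.
  move=> s s0 sy; rewrite leNgt; apply/negP => h; apply: nex; by exists s.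
have hs : I01 s by apply: I01_intro => //; move: (I01_le1 (phi01 y)); lra.
apply: eventually_imply (gt y s s0 sy) => j sj.
rewrite leNgt; apply/negP => bj; move: lts; apply/negP; rewrite -leNgt.
apply: le_trans (fuzzy_hom_lpart hT y (n j) x).
by apply: (T_mono hT) => //; [exact: fuzzy_hom_I01|exact: ltW].
Qed.

Lemma eventually_le_rpart x b : b < presup_right x ->
  net_eventually le (fun j => b <= rpart (n j) x).
Proof.
case: hn => hle gt _ _ bx.
have [b0|b0] := ltP b 0.
  have [i _] : exists i : D, True by case: hle.
  by exists i => j _; apply: (le_trans (ltW b0)); exact: I01_ge0.
have [_ [y _ <-] lty] := sup01_gt b0 bx.
have [s [s0 sy lts]] : exists s, [/\ 0 <= s, s < phi y & b < T s (rpart y x)].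
  apply: contrapT => nex; move: lty; apply/negP; rewrite -leNgt.
  apply: (T_approx_l hT) => //.
  move=> s s0 sy; rewrite leNgt; apply/negP => h; apply: nex; by exists s.
have hs : I01 s by apply: I01_intro => //; move: (I01_le1 (phi01 y)); lra.
apply: eventually_imply (gt y s s0 sy) => j sj.
apply: (le_trans (ltW lts)); apply: le_trans (fuzzy_hom_rpart hT y (n j) x).
by apply: (T_mono hT) => //; exact: fuzzy_hom_I01.
Qed.

End Net.

Lemma ideal_inhabited s : 0 <= s -> s < 1 -> exists y, s <= phi y.
Proof.
have [D [le [n [hle _ _ h]]]] := ideal_represents hX hphi.
by move=> s0 s1; have [j hj] := eventually_exists hle (h s s0 s1); exists (n j).
Qed.

Lemma colim_left_profile : left_profile M colim_left.
Proof.
have h01 := colim_left_I01.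
split=> //.
- move=> x x' xx'; apply/le_colim_left => // y.
  have /le_colim_left h := lexx (colim_left x).
  by apply: (le_trans (h (h01 x) y)); exact: (left_mono (lpartP y)).
- move=> x a xa; have [a1|a1] := leP a 1; last first.
    by exists 1 => //; apply: le_lt_trans a1; exact: I01_le1.
  have a0 : 0 < a := le_lt_trans (I01_ge0 (h01 x)) xa.
  have ha : I01 a by apply: I01_intro => //; exact: ltW.
  have [y /negP] : exists y, ~ T (phi y) a <= lpart y x.
    by apply/existsNP => /(le_colim_left x ha); rewrite leNgt xa.
  rewrite -ltNge => /(left_rcont (lpartP y))[d d0 hd]; exists d => //.
  rewrite ltNge; apply/negP => /(le_colim_left _ ha)/(_ y).
  by rewrite leNgt hd.
- move=> x xM; apply/eqP; rewrite eq_le (I01_ge0 (h01 x)) andbT.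
  rewrite -(T1x hT (h01 x)).
  apply: (T_approx_l hT) => // s s0 s1; have [y sy] := ideal_inhabited s0 s1.
  have hs : I01 s by apply: I01_intro => //; exact: ltW.
  rewrite -(left_before (lpartP y) xM).
  have /le_colim_left h := lexx (colim_left x).
  by apply: le_trans (h (h01 x) y); exact: (T_mono hT).
- move=> x Mx; apply/eqP; rewrite eq_le (I01_le1 (h01 x)) /=.
  apply/le_colim_left => // y; rewrite (left_after (lpartP y) Mx).
  by rewrite (Tx1 hT) //; exact: I01_le1.
Qed.

Lemma presup_right_eq1 x :
  (forall s, 0 <= s -> s < 1 -> exists2 y, s <= phi y & rpart y x = 1) ->
  presup_right x = 1.
Proof.
move=> h; apply/eqP; rewrite eq_le (I01_le1 (presup_right_I01 x)) /=.
apply: le_of_all_lt; last exact/I01_ge0/presup_right_I01.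
move=> s s0 s1; have [y sy y1] := h s s0 s1.
apply: le_trans (le_presup_right x y).
by rewrite y1 (Tx1 hT).
Qed.

Lemma colim_right_profile : right_profile M colim_right.
Proof.
have h01 := colim_right_I01.
split=> //.
- move=> x x' xx'; apply/le_colim_right; split=> [|z zx]; first exact: I01_le1.
  by apply: colim_right_le; exact: lt_le_trans xx'.
- move=> x a xa; have [a1|a1] := leP a 1; last first.
    by exists 1 => //; apply: le_lt_trans a1; exact: I01_le1.
  have [_ [z zx <-] za] := inf01_lt a1 (@colim_right_set x) xa.
  rewrite /= in zx; exists ((x - z) / 2); first by lra.
  by apply: le_lt_trans za; apply: colim_right_le; lra.
- move=> x Mx; apply/eqP; rewrite eq_le (I01_ge0 (h01 x)) andbT.
  apply: (@le_trans _ _ (presup_right ((x + M) / 2))); first by apply: colim_right_le; lra.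
  apply: presup_right_le => // y.
  by rewrite (right_after (rpartP y)) ?(Tx0 hT) //; lra.
- move=> x xM; apply/eqP; rewrite eq_le (I01_le1 (h01 x)) /=.
  apply/le_colim_right; split=> // z zx; rewrite presup_right_eq1 // => s s0 s1.
  have [y sy] := ideal_inhabited s0 s1; exists y => //.
  by apply: (right_before (rpartP y)); lra.
Qed.

(** To the left of the first point where [colim_left] reaches 1, the left parts
    along the net are eventually below 1, so the right parts are 1 there. *)
Lemma colim_core : exists c, colim_left c = 1 /\ colim_right c = 1.
Proof.
have hl := colim_left_profile.
pose A := [set x | 1 <= colim_left x].
have AM : A M by rewrite /A /= (left_after hl).
have A_lb : has_lbound A.
  exists (- M) => x; rewrite /A /= => x1; rewrite leNgt; apply/negP => /(left_before hl); lra.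
pose a := inf A.
have a_le x : 1 <= colim_left x -> a <= x by move=> x1; exact: ge_inf.
have la : colim_left a = 1.
  apply/eqP; rewrite eq_le (I01_le1 (colim_left_I01 a)) /= leNgt; apply/negP.
  move=> /(left_rcont hl)[d d0 hd].
  have lt1 : a < a + d by lra.
  have [|//|x Ax xd] := @inf_lt _ A (a + d); first by exists M.
  have := left_mono hl (ltW xd); move: Ax; rewrite /A /=; lra.
exists a; split=> //; apply/eqP; rewrite eq_le (I01_le1 (colim_right_I01 a)) /=.
apply/le_colim_right; split=> // z za.
have [D [le [n hn]]] := ideal_represents hX hphi.
have z1 : colim_left z < (colim_left z + 1) / 2.
  suff : colim_left z < 1 by lra.
  by rewrite ltNge; apply/negP => /a_le; lra.
have ev := eventually_lpart_le hn z1.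
have [hle _ _ hin] := hn.
rewrite presup_right_eq1 // => s s0 s1.
have [j [lj sj]] := eventually_exists hle (eventually_and hle ev (hin s s0 s1)).
exists (n j) => //; have [c [lc rc]] := part_core (n j).
have zc : z <= c.
  rewrite leNgt; apply/negP => /ltW/(left_mono (lpartP (n j))); rewrite lc.
  by lra.
apply/eqP; rewrite eq_le (I01_le1 (rpart_I01 _ _)) /= -rc.
exact: (right_anti (rpartP _)).
Qed.

Lemma colim_exists : exists k : X, lpart k = colim_left /\ rpart k = colim_right.
Proof.
have [c [lc rc]] := colim_core.
exact: (fuzzy_of_profiles colim_left_profile colim_right_profile lc rc).
Qed.

(** On the right, the regularization is harmless because the right part of the
    target [v] is left continuous. *)
Lemma is_colimit_of_parts k : lpart k = colim_left -> rpart k = colim_right ->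
  is_colimit T hom phi k.
Proof.
move=> kl kr; apply/(is_colimitP hT hX) => // v r hr.
have TTr y x : T (T (phi y) r) (rpart y x) = T r (T (phi y) (rpart y x)).
  by rewrite (T_comm hT (phi01 y)) // -(T_assoc hT).
rewrite le_fuzzy_hom // kl kr; split=> [h y|h x].
  apply/(le_fuzzy_hom hT); first exact: T_I01.
  move=> x; have [h1 h2] := h x; split.
    rewrite -(T_assoc hT) //; have /le_colim_left hl := lexx (colim_left x).
    apply: le_trans (hl (colim_left_I01 x) y).
    by apply: (T_mono hT) => //; [exact: T_I01|exact: colim_left_I01].
  rewrite TTr; apply: le_trans h2.
  apply: (T_mono hT) => //; [exact: T_I01|exact: colim_right_I01|].
  exact: le_colim_right_part.
have hy y x' : T (T (phi y) r) (lpart v x') <= lpart y x' /\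
    T (T (phi y) r) (rpart y x') <= rpart v x'.
  by move: x'; apply/(le_fuzzy_hom hT); [exact: T_I01|exact: h].
split.
  apply/le_colim_left; first exact: T_I01.
  by move=> y; rewrite (T_assoc hT) //; case: (hy y x).
rewrite leNgt; apply/negP => /(right_lcont (rpartP v)) [d d0].
apply/negP; rewrite -leNgt.
have hp := presup_right_I01 (x - d).
apply: (@le_trans _ _ (T r (presup_right (x - d)))).
  by apply: (T_mono hT) => //; [exact: colim_right_I01|apply: colim_right_le; lra].
rewrite (T_comm hT) //; apply: (T_approx_l hT) => //; first exact: I01_ge0.
move=> s s0 sp; have [_ [y _ <-] sy] := sup01_gt s0 sp.
have hs : I01 s by apply: I01_intro => //; move: (I01_le1 hp); lra.
have [_ h2] := hy y (x - d); apply: le_trans h2; rewrite TTr (T_comm hT) //.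
by apply: (T_mono hT) => //; [exact: T_I01|exact: ltW].
Qed.

End Parts.

Lemma fuzzy_yoneda_complete : yoneda_complete T hom.
Proof.
move=> phi hphi; have [k [kl kr]] := colim_exists hphi; exists k.
exact: is_colimit_of_parts.
Qed.

End Colimit.

(** * Approximation from below *)

Section Approximation.
Variables (R : realType) (T : R -> R -> R) (M : R).
Hypothesis hT : continuous_tnorm T.
Notation X := (fuzzy_on M).
Notation hom := (@fuzzy_on_hom R T M).
Let hX : enriched_category T hom := fuzzy_enriched_category M hT.
Implicit Types (u v w y : X) (r s x c d : R).

Lemma fuzzy_hom_eq1 u v :
  (forall x, lpart v x <= lpart u x /\ rpart u x <= rpart v x) -> hom u v = 1.
Proof.
move=> h; apply/eqP; rewrite eq_le I01_le1 /=; last exact: fuzzy_hom_I01.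
by apply/(le_fuzzy_hom hT) => // x; rewrite !(T1x hT).
Qed.

(** The shifted graphs of the two parts would no longer have a common point of
    value 1. The value 1 is therefore kept on the right up to [c - d], with [c]
    in the core of [u], which is where [approx_left] reaches 1 at the latest.
    No vertical gap is needed at this height, since [T r 1 = r]. *)
Definition approx_left u d x : R :=
  if x < - M then 0 else Num.min 1 (lpart u (x + d) + d).

Definition approx_right u c d x : R :=
  if x <= Num.max (- M) (c - d) then 1 else Num.max 0 (rpart u (x + d) - d).

Section Core.
Variables (u : X) (c : R).
Hypotheses (lc : lpart u c = 1) (rc : rpart u c = 1).

Lemma core_bounds : - M <= c <= M.
Proof.
apply/andP; split; rewrite leNgt; apply/negP.
  by move/(left_before (lpartP u)); rewrite lc => /eqP; rewrite oner_eq0.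
by move/(right_after (rpartP u)); rewrite rc => /eqP; rewrite oner_eq0.
Qed.

Lemma approx_left_profile d : 0 < d -> left_profile M (approx_left u d).
Proof.
move=> d0; have d0' := ltW d0; have hu := lpartP u; split.
- move=> x; rewrite /approx_left; case: ifP => // _.
  apply: I01_intro; last by rewrite ge_min lexx.
  by rewrite le_min ler01 addr_ge0 // I01_ge0.
- move=> x x' xx'; rewrite /approx_left.
  case: (ltP x (- M)) => xM; case: (ltP x' (- M)) => x'M //.
  + by rewrite le_min ler01 addr_ge0 // I01_ge0.
  + by lra.
  + have h : lpart u (x + d) <= lpart u (x' + d) by apply: (left_mono hu); lra.
    by rewrite le_min !ge_min lexx /=; apply/orP; right; lra.
- move=> x a; rewrite /approx_left; case: (ltP x (- M)) => xM.
    move=> a0; exists ((- M - x) / 2); first by lra.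
    by rewrite ifT //; lra.
  rewrite gt_min => /orP[a1|xa].
    exists 1 => //; rewrite ifF; last by apply/negP; lra.
    by rewrite gt_min a1.
  have [|e e0 he] := left_rcont hu (x := x + d) (a := a - d); first by lra.
  exists e => //; rewrite ifF; last by apply/negP; lra.
  by rewrite gt_min addrAC; apply/orP; right; lra.
- by move=> x xM; rewrite /approx_left xM.
- move=> x Mx; have := core_bounds => cM; rewrite /approx_left ifF; last by apply/negP; lra.
  by rewrite (left_after hu) ?(min_idPl _) //; lra.
Qed.

Lemma approx_right_profile d : 0 < d -> right_profile M (approx_right u c d).
Proof.
move=> d0; have hu := rpartP u; have cM := core_bounds.
have cdM : Num.max (- M) (c - d) <= M by rewrite ge_max; lra.
split.
- move=> x; rewrite /approx_right; case: ifP => // _.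
  apply: I01_intro; first by rewrite le_max lexx.
  by rewrite ge_max ler01 /=; have := I01_le1 (rpart_I01 u (x + d)); lra.
- move=> x x' xx'; rewrite /approx_right.
  case: (leP x (Num.max _ _)) => xM; case: (leP x' (Num.max _ _)) => x'M //.
  + rewrite ge_max ler01 /=; have := I01_le1 (rpart_I01 u (x' + d)); lra.
  + by have := le_trans xx' x'M; rewrite leNgt xM.
  + have h : rpart u (x' + d) <= rpart u (x + d) by apply: (right_anti hu); lra.
    by rewrite ge_max !le_max lexx /=; apply/orP; right; lra.
- move=> x a; rewrite /approx_right; case: (leP x (Num.max _ _)) => xM.
    move=> a1; exists 1 => //; rewrite ifT //; apply: le_trans xM; lra.
  rewrite gt_max => /andP[a0 xa].
  have [|e e0 he] := right_lcont hu (x := x + d) (a := a + d); first by lra.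
  set b := Num.max _ _ in xM *.
  have m0 : 0 < Num.min e (x - b) by rewrite lt_min e0; lra.
  have m1 : Num.min e (x - b) <= e by rewrite ge_min lexx.
  have m2 : Num.min e (x - b) <= x - b by rewrite ge_min lexx orbT.
  exists (Num.min e (x - b) / 2); first by lra.
  rewrite ifF; last by apply/negP; lra.
  rewrite gt_max a0 /= ltrBlDr; apply: le_lt_trans he.
  by apply: (right_anti hu); lra.
- move=> x Mx; rewrite /approx_right ifF; last by apply/negP; lra.
  by rewrite (right_after hu) ?(max_idPl _) //; lra.
- by move=> x xM; rewrite /approx_right ifT // le_max xM.
Qed.

Lemma approx_exists d : 0 < d ->
  exists v, lpart v = approx_left u d /\ rpart v = approx_right u c d.
Proof.
move=> d0; pose b := Num.max (- M) (c - d).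
have b1 : - M <= b by rewrite le_max lexx.
have b2 : c - d <= b by rewrite le_max lexx orbT.
apply: (fuzzy_of_profiles (approx_left_profile d0) (approx_right_profile d0) (c := b)).
- rewrite /approx_left ifF; last by apply/negP; lra.
  rewrite (min_idPl _) //.
  have : lpart u c <= lpart u (b + d) by apply: (left_mono (lpartP u)); lra.
  by rewrite lc; lra.
- by rewrite /approx_right lexx.
Qed.

Lemma approx_incr d d' v v' : 0 < d' -> d' <= d ->
  lpart v = approx_left u d -> rpart v = approx_right u c d ->
  lpart v' = approx_left u d' -> rpart v' = approx_right u c d' -> hom v v' = 1.
Proof.
move=> d0 dd' vl vr vl' vr'; apply: fuzzy_hom_eq1 => x; rewrite vl vr vl' vr'; split.
- rewrite /approx_left; case: ifP => // _.
  have : lpart u (x + d') <= lpart u (x + d) by apply: (left_mono (lpartP u)); lra.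
  by rewrite le_min !ge_min lexx /= => h; apply/orP; right; lra.
- have hp := approx_right_profile d0.
  rewrite {1}/approx_right; case: ifP => xM.
    rewrite /approx_right ifT //; apply: (le_trans xM).
    by rewrite ge_max !le_max lexx /=; apply/orP; right; lra.
  rewrite ge_max (I01_ge0 (right_I01 hp x)) /= /approx_right; case: ifP => _.
    by have := I01_le1 (rpart_I01 u (x + d)); lra.
  have h : rpart u (x + d) <= rpart u (x + d') by apply: (right_anti (rpartP u)); lra.
  by rewrite le_max; apply/orP; right; lra.
Qed.

(** One-sided continuity of the left part of [u] and of the right part of [w]
    compensates for the horizontal shift. *)
Lemma approx_dense w r (n : R -> X) : I01 r ->
  (forall d, 0 < d ->
     lpart (n d) = approx_left u d /\ rpart (n d) = approx_right u c d) ->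
  (forall e, 0 < e -> exists d, [/\ 0 < d, d < e & r <= hom (n d) w]) ->
  r <= hom u w.
Proof.
move=> hr hn h; apply/(le_fuzzy_hom hT) => // x; split.
- rewrite leNgt; apply/negP; set b := T r _ => lb.
  have [e e0 he] := left_rcont (lpartP u) lb.
  have m0 : 0 < Num.min e (b - lpart u (x + e)) by rewrite lt_min e0 subr_gt0.
  have [d [d0 dm rd]] := h _ m0.
  have m1 : Num.min e (b - lpart u (x + e)) <= e by rewrite ge_min lexx.
  have m2 : Num.min e (b - lpart u (x + e)) <= b - lpart u (x + e) by rewrite ge_min lexx orbT.
  have [nl _] := hn d d0.
  have /(le_fuzzy_hom hT _ _ hr) /(_ x)[+ _] := rd; rewrite nl -/b /approx_left.
  have u0 := I01_ge0 (lpart_I01 u x); case: ifP => _; first by lra.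
  have : lpart u (x + d) <= lpart u (x + e) by apply: (left_mono (lpartP u)); lra.
  by rewrite le_min => h1 /andP[_]; lra.
- rewrite leNgt; apply/negP => /(right_lcont (rpartP w))[e e0].
  apply/negP; rewrite -leNgt; apply: (T_approx hT) => // eps eps0.
  have m0 : 0 < Num.min e eps by rewrite lt_min e0.
  have [d [d0 dm rd]] := h _ m0; have [_ nr] := hn d d0.
  have m1 : Num.min e eps <= e by rewrite ge_min lexx.
  have m2 : Num.min e eps <= eps by rewrite ge_min lexx orbT.
  have /(le_fuzzy_hom hT _ _ hr) /(_ (x - d))[_ le1] := rd.
  exists r, (rpart (n d) (x - d)); split=> //; first by lra.
    rewrite nr /approx_right subrK; have := I01_le1 (rpart_I01 u x).
    case: ifP => _; first by lra.
    by rewrite lt_max => _; apply/orP; right; lra.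
  apply: (le_trans le1).
  have : rpart w (x - d) <= rpart w (x - e) by apply: (right_anti (rpartP w)); lra.
  by lra.
Qed.

(** ** Ideals absorb the approximations of elements below their colimit *)

Hypothesis noT : no_idempotent_square T.

(** The shift by [d] turns the pointwise convergence of the net into a
    condition at finitely many grid points; the vertical gap [d] is handled by
    continuity of [T] for the left parts, and for the right parts by its strict
    monotonicity, which is where the hypothesis on idempotents enters. *)
Lemma approx_absorbed d v phi k : 0 < d ->
  lpart v = approx_left u d -> rpart v = approx_right u c d ->
  forward_cauchy_ideal T hom phi ->
  lpart k = colim_left T phi -> rpart k = colim_right T phi ->
  hom u k <= phi v.
Proof.
move=> d0 vl vr hphi kl kr; have hr := fuzzy_hom_I01 T u k.
have hrl x : T (hom u k) (colim_left T phi x) <= lpart u x.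
  by rewrite -kl; exact: fuzzy_hom_lpart.
have hrr x : T (hom u k) (rpart u x) <= colim_right T phi x.
  by rewrite -kr; exact: fuzzy_hom_rpart.
set r := hom u k in hr hrl hrr *.
apply: le_of_all_lt; last exact: I01_ge0 (ideal_I01 v hphi).
move=> r' r'0 r'r; have hr' : I01 r' by apply: I01_intro => //; move: (I01_le1 hr); lra.
have [D [le [n hn]]] := ideal_represents hX hphi.
have [hle _ le_phi _] := hn; apply: le_phi; first exact: I01_le1.
have [eta0 eta00 strict] := T_strict_uniform hT noT hr' hr r'r d0.
pose eta := Num.min eta0 (r - r').
have eta_gt0 : 0 < eta by rewrite lt_min eta00 subr_gt0.
have eta_le0 : eta <= eta0 by rewrite ge_min lexx.
have eta_ler : eta <= r - r' by rewrite ge_min lexx orbT.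
(* The mesh is half of the shift, so that every [x] is followed by a grid point
   strictly before [x + d], as [colim_right_le] requires. *)
pose t (i : nat) := - M + i%:R * (d / 2).
have ev i : net_eventually le (fun j => T r' (lpart (n j) (t i)) <= lpart u (t i) + d /\
    presup_right T phi (t i) - eta <= rpart (n j) (t i)).
  apply: (eventually_and hle); last by apply: (eventually_le_rpart hT hphi hn); lra.
  have hF := colim_left_I01 T phi (t i).
  have [e e0 he] := T_cont hT hr' hF d0.
  have lt1 : colim_left T phi (t i) < colim_left T phi (t i) + e / 2 by lra.
  apply: eventually_imply (eventually_lpart_le hT hphi hn lt1) => j ltj.
  have le1 : T r' (colim_left T phi (t i)) <= lpart u (t i).
    by apply: le_trans (hrl _); apply: (T_mono hT) => //; exact: ltW.
  have [leF|ltF] := leP (lpart (n j) (t i)) (colim_left T phi (t i)).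
    have : T r' (lpart (n j) (t i)) <= T r' (colim_left T phi (t i)) by exact: (T_mono hT).
    by lra.
  have : `|T r' (colim_left T phi (t i)) - T r' (lpart (n j) (t i))| < d.
    by apply: he; rewrite ?subrr ?normr0 // ltr_norml; lra.
  by rewrite ltr_norml; lra.
have [N hN] : exists N : nat, (M + M) / (d / 2) < N%:R.
  by exists (Num.truncn ((M + M) / (d / 2))).+1; exact: truncnS_gt.
apply: eventually_imply (eventually_forall_leq hle (fun i (_ : (i <= N)%N) => ev i)) => j hj.
have vP := lpartP v; have vP' := rpartP v; have jP := lpartP (n j); have jP' := rpartP (n j).
apply/(le_fuzzy_hom hT) => // x.
have [xM|Mx] := ltP x (- M).
  rewrite (left_before jP xM) (right_before jP' (ltW xM)) (Tx0 hT) //.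
  by split; [exact: I01_ge0|apply: I01_le1; exact: T_I01].
have [Mx'|xM] := ltP M x.
  rewrite (left_after vP (ltW Mx')) (right_after vP' Mx') (Tx0 hT) //.
  by split; [apply: I01_le1; exact: T_I01|exact: I01_ge0].
have d20 : 0 < d / 2 by lra.
have [i iN /andP[xt txd]] : exists2 i : nat, (i <= N)%N & x <= t i <= x + d / 2.
  have y0 : 0 <= (x + M) / (d / 2) by rewrite divr_ge0 //; lra.
  have /andP[k1 k2] := truncn_itv y0.
  set K := Num.truncn _ in k1 k2; exists K.+1.
    rewrite -(ltr_nat R); apply: (le_lt_trans k1); apply: le_lt_trans hN.
    by rewrite ler_pM2r ?invr_gt0 //; lra.
  have KE : K.+1%:R * (d / 2) = K%:R * (d / 2) + d / 2 by rewrite -[K.+1]addn1 natrD; ring.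
  by move: k1 k2; rewrite ler_pdivlMr // ltr_pdivrMr // /t KE; lra.
have [h1 h2] := hj i iN.
have h3 : rpart (n j) (t i) <= rpart (n j) x by exact: (right_anti jP').
have h4 : T r (rpart u (x + d)) - eta <= rpart (n j) x.
  apply: le_trans h3; apply: le_trans h2; rewrite lerD2r.
  by apply: (le_trans (hrr _)); apply: colim_right_le => //; lra.
split.
- rewrite vl /approx_left ifF; last by apply/negP; lra.
  rewrite le_min I01_le1 /=; last exact: T_I01.
  apply: (@le_trans _ _ (T r' (lpart (n j) (t i)))).
    by apply: (T_mono hT) => //; exact: (left_mono jP).
  have : lpart u (t i) <= lpart u (x + d) by apply: (left_mono (lpartP u)); lra.
  by lra.
- rewrite vr /approx_right; case: ifP => [|_].
    rewrite le_max => /orP[xM'|xc].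
      have -> : x = - M by lra.
      by rewrite (right_before jP') // (Tx1 hT) //; exact: I01_le1.
    rewrite (Tx1 hT) //.
    have rE : rpart u (x + d) = 1.
      apply/eqP; rewrite eq_le I01_le1 //= -rc.
      by apply: (right_anti (rpartP u)); lra.
    by move: h4; rewrite rE (Tx1 hT) //; lra.
  have hm : I01 (Num.max 0 (rpart u (x + d) - d)).
    apply: I01_intro; first by rewrite le_max lexx.
    by rewrite ge_max ler01 /=; have := I01_le1 (rpart_I01 u (x + d)); lra.
  rewrite (T_comm hT) //; apply: (le_trans (strict _ (rpart_I01 u _))).
  rewrite ge_max I01_ge0 //= (T_comm hT) //.
  by lra.
Qed.

End Core.

Lemma fuzzy_continuous_category : no_idempotent_square T -> continuous_category T hom.
Proof.
move=> noT; apply: (continuous_category_intro hT hX); first exact: fuzzy_yoneda_complete.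
move=> u; have [c [lc rc]] := part_core u.
have /choice[n hn] : forall d, exists v, 0 < d ->
    lpart v = approx_left u d /\ rpart v = approx_right u c d.
  move=> d; have [d0|d0] := ltP 0 d; last by exists u.
  by have [v hv] := approx_exists lc rc d0; exists v.
have [dn [dn01 dn_anti dn_lt]] := vanishing_sequence R.
have dn0 i : 0 < dn i by have /andP[] := dn01 i.
have n_incr i j : (i <= j)%N -> hom (n (dn i)) (n (dn j)) = 1.
  move=> ij; have [il ir] := hn _ (dn0 i); have [jl jr] := hn _ (dn0 j).
  by apply: (approx_incr lc rc (dn0 j) _ il ir jl jr); exact: dn_anti.
exists (sequence_weight hom (fun i => n (dn i))).
  exact: sequence_weight_ideal.
apply: (sequence_way_below hT hX) => //.
- move=> phi k i hphi hk; have [k0 [k0l k0r]] := colim_exists hT hphi.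
  have hk0 := is_colimit_of_parts hT hphi k0l k0r.
  have [il ir] := hn _ (dn0 i).
  apply: (@le_trans _ _ (hom u k0)); last first.
    exact: (approx_absorbed rc noT (dn0 i) il ir hphi k0l k0r).
  apply: (hom_comp1l hT hX).
  by apply: (colimit_unique hT hX _ hk hk0) => y; exact: ideal_I01 hphi.
- move=> w r hr hw; apply: (approx_dense hr hn) => e e0.
  by have [i ie] := dn_lt e e0; exists (dn i).
Qed.

End Approximation.

(** * Failure of continuity at an idempotent square *)

Section Converse.
Variables (R : realType) (T : R -> R -> R) (M : R).
Hypothesis hT : continuous_tnorm T.
Hypothesis hM : 0 < M.
Notation X := (fuzzy_on M).
Notation hom := (@fuzzy_on_hom R T M).
Let hX : enriched_category T hom := fuzzy_enriched_category M hT.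
Implicit Types (u v w k : X) (a b e m r s x : R).

Definition step_left x : R := if x < - M then 0 else 1.

Definition plateau a b x : R := if x <= - M then 1 else if x <= b then a else 0.

Lemma plateau_exists a b : I01 a -> b <= M ->
  exists u : X, lpart u = step_left /\ rpart u = plateau a b.
Proof.
move=> ha bM; have M0 := hM; have a0 := I01_ge0 ha; have a1 := I01_le1 ha.
apply: (fuzzy_of_profiles (c := - M)).
- split.
  + by move=> x; rewrite /step_left; case: ifP.
  + by move=> x y xy; rewrite /step_left; case: (ltP x); case: (ltP y) => //; lra.
  + move=> x z; rewrite /step_left; case: (ltP x (- M)) => xM xz.
      by exists ((- M - x) / 2); [lra|rewrite ifT //; lra].
    by exists 1 => //; rewrite ifF //; apply/negP; lra.
  + by move=> x xM; rewrite /step_left xM.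
  + by move=> x Mx; rewrite /step_left ifF //; apply/negP; lra.
- split.
  + by move=> x; rewrite /plateau; case: ifP => // _; case: ifP.
  + move=> x y xy; rewrite /plateau; case: (leP x (- M)) => x1; case: (leP y (- M)) => y1;
      case: (leP x b) => x2; case: (leP y b) => y2 //; lra.
  + move=> x z; rewrite /plateau; case: (leP x (- M)) => x1; last case: (leP x b) => x2; move=> xz.
    * by exists 1 => //; rewrite ifT //; lra.
    * exists ((x + M) / 2); first by lra.
      by rewrite ifF ?ifT //; [lra|apply/negP; lra].
    * have m0 : 0 < Num.min (x - b) (x + M) by rewrite lt_min; lra.
      have m1 : Num.min (x - b) (x + M) <= x - b by rewrite ge_min lexx.
      have m2 : Num.min (x - b) (x + M) <= x + M by rewrite ge_min lexx orbT.
      exists (Num.min (x - b) (x + M) / 2); first by lra.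
      by rewrite ifF ?ifF //; apply/negP; lra.
  + by move=> x Mx; rewrite /plateau ifF ?ifF //; apply/negP; lra.
  + by move=> x xM; rewrite /plateau xM.
- by rewrite /step_left ltxx.
- by rewrite /plateau lexx.
Qed.

(** Suppose [T m m = e < m] with [e > 0] idempotent. Fuzzy numbers whose right
    part has a plateau of height below [e] increase to one, [w], of height [e],
    and [hom u w >= m] for the plateau [u] of height [m], since [m -> e] is at
    least [m]. An ideal that is sent to [u] contains the short plateau [v] of
    height [e] with degree 1, because its net eventually exceeds [e] there;
    but the ideal of the increasing sequence contains [v] with degree [e] only,
    as [e -> y = y] for [y < e]. *)
Lemma continuous_no_idempotent_square :
  continuous_category T hom -> no_idempotent_square T.
Proof.
case=> colim [hcolim [f [_ _ hadj]]] e m ide e0 hm em mme.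
have M0 := hM; have [he ee] := ide.
have [q [q01 q_anti q_lt]] := vanishing_sequence R.
pose y (i : nat) := e - e * q i.
have hy i : 0 <= y i < e.
  have /andP[h1 h2] := q01 i; rewrite /y subr_ge0 gtrBl mulr_gt0 // andbT.
  by rewrite ler_piMr // ltW.
have y01 i : I01 (y i).
  by have /andP[h1 h2] := hy i; apply: I01_intro => //; move: (I01_le1 he); lra.
have y_incr i j : (i <= j)%N -> y i <= y j.
  by move=> ij; rewrite /y lerD2l lerN2 ler_pM2l // q_anti.
have [u [ul ur]] := plateau_exists hm (lexx M).
have [w [wl wr]] := plateau_exists he (lexx M).
have [v [vl vr]] := plateau_exists he (ltW hM).
have /choice[n hn] : forall i, exists n : X, lpart n = step_left /\ rpart n = plateau (y i) M.
  by move=> i; exact: plateau_exists.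
have n_incr i j : (i <= j)%N -> hom (n i) (n j) = 1.
  move=> /y_incr yij; apply: (fuzzy_hom_eq1 hT) => x.
  have [-> ->] := hn i; have [-> ->] := hn j; split=> //.
  by rewrite /plateau; case: ifP => // _; case: ifP.
pose phi : ideals T hom := exist _ _ (sequence_weight_ideal hT hX n_incr).
have phi01 z : I01 (sval phi z) by exact: ideal_I01 (svalP phi).
have w_colim : hom w (colim phi) = 1.
  have nk i : hom (n i) (colim phi) = 1.
    apply/eqP; rewrite eq_le (I01_le1 (hom_I01 hX _ _)) /=.
    rewrite -(sequence_weight_self hT hX n_incr i).
    exact: (colimit_unit hT hX _ phi01 (hcolim phi)).
  have nkx i x : lpart (colim phi) x <= step_left x /\ plateau (y i) M x <= rpart (colim phi) x.
    have [il ir] := hn i.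
    have := fuzzy_hom_lpart hT (n i) (colim phi) x.
    have := fuzzy_hom_rpart hT (n i) (colim phi) x.
    by rewrite nk !(T1x hT) // il ir.
  apply: (fuzzy_hom_eq1 hT) => x; rewrite wl wr; split; first by case: (nkx 0%N x).
  have k0 := I01_ge0 (rpart_I01 (colim phi) x).
  rewrite /plateau; case: ifP => x1; first by have [_] := nkx 0%N x; rewrite /plateau x1.
  case: ifP => x2 //; rewrite leNgt; apply/negP => ke.
  have d0 : 0 < e - rpart (colim phi) x by lra.
  have [i qi] := q_lt _ d0.
  have [_] := nkx i x; rewrite /plateau x1 x2 /y.
  have /andP[q0 _] := q01 i; have e1 := I01_le1 he.
  have : e * q i <= q i by rewrite ler_piMl // ltW.
  by lra.
have m_le : m <= hom u (colim phi).
  apply: (@le_trans _ _ (hom u w)); last exact: (hom_comp1l hT hX).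
  apply/(le_fuzzy_hom hT) => // x; split.
    by rewrite ul wl (T_le_r hT) // /step_left; case: ifP.
  rewrite ur wr /plateau; case: ifP => _; first by apply: I01_le1; exact: T_I01.
  by case: ifP => _; [rewrite mme|rewrite (Tx0 hT)].
(* The plateau of [v] stops at 0, before that of [u], since the right part of
   the colimit of [f u] at [M] only controls the net at points before [M]. *)
have psi_v : sval (f u) v = 1.
  have hpsi := svalP (f u); set psi := sval (f u) in hpsi *.
  have uc : hom u (colim (f u)) = 1 by rewrite -hadj (ideals_homxx hT).
  have [k [kl kr]] := colim_exists hT hpsi.
  have ck : hom (colim (f u)) k = 1.
    apply: (colimit_unique hT hX _ (hcolim (f u))); last exact: is_colimit_of_parts.
    by move=> z; exact: ideal_I01 hpsi.
  have uk : hom u k = 1.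
    apply/eqP; rewrite eq_le (I01_le1 (hom_I01 hX _ _)) /= -uc.
    exact: (hom_comp1l hT hX).
  have ltp : e < presup_right T psi 0.
    apply: (lt_le_trans em); apply: le_trans (colim_right_le hT hpsi hM).
    have := fuzzy_hom_rpart hT u k M.
    rewrite uk (T1x hT) // kr ur /plateau ifF ?lexx //; apply/negP; lra.
  have [D [le [nn hnn]]] := ideal_represents hX hpsi.
  have [_ _ le_psi _] := hnn.
  apply/eqP; rewrite eq_le (I01_le1 (ideal_I01 _ hpsi)) /=; apply: le_psi => //.
  apply: eventually_imply (eventually_le_rpart hT hpsi hnn ltp) => j ej.
  rewrite (fuzzy_hom_eq1 hT) // => x; rewrite vl vr /step_left /plateau; split.
    case: (ltP x (- M)) => xM; first by rewrite (left_before (lpartP _) xM).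
    exact: I01_le1.
  case: ifP => x1; first by rewrite (right_before (rpartP _) x1).
  case: ifP => x2; last exact: I01_ge0.
  by apply: (le_trans ej); exact: (right_anti (rpartP _)).
have phi_v : sval phi v <= e.
  rewrite leNgt; apply/negP => /(sequence_weight_gt hX (ltW e0))[i ei].
  have /(le_fuzzy_hom hT) := ei => /(_ he 0)[_].
  have zM : (0 <= - M) = false by apply/negP; lra.
  have [_ ->] := hn i; rewrite vr /plateau zM lexx (ltW hM) ee.
  by have /andP[_ yi] := hy i; rewrite leNgt yi.
have : T (sval (f u) v) m <= sval phi v.
  by move: v {vl vr psi_v phi_v}; apply/(ideals_homP hT) => //; rewrite hadj.
by rewrite psi_v (T1x hT) //; lra.
Qed.

End Converse.

(** * Domains of fuzzy numbers *)

Theorem theorem5p25 (R : realType) (T : R -> R -> R) (M : R)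
    (hT : continuous_tnorm T) (hM : 0 < M) :
  enriched_domain T (@fuzzy_on_hom R T M) <-> S_condition T.
Proof.
split=> [[_ _ hc]|hS].
  apply: no_idempotent_square_S_condition => //.
  exact: continuous_no_idempotent_square hc.
split.
- exact: fuzzy_enriched_category.
- exact: fuzzy_yoneda_complete.
- by apply: fuzzy_continuous_category => //; exact: S_condition_no_idempotent_square.
Qed.
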